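(* Let $\mathcal G$ be an embedded proper level-planar graph (containing the boundary paths $p_L,p_R$) and let $\lambda\in\mathbb N$. The circulations in $F_{\mathcal G}^\lambda$ correspond bijectively to the $\lambda$-drawings of $\mathcal G$ (via the maps $\Gamma\mapsto x^\star$, where $x$ is the $x$-coordinate function of $\Gamma$, and $\varphi\mapsto\varphi^\star$).
   Context: A $k$-level graph is a directed graph $G=(V,E)$ with $\ell:V\to\{1,\dots,k\}$; proper means $\ell(v)=\ell(u)+1$ for every edge $(u,v)$. A level drawing places $v$ at $(\Gamma(v),\ell(v))$, edges as $y$-monotone curves; level-planar means no crossings except at common endpoints. An embedding is a left-to-right order of the vertices on each level (as induced by a level-planar drawing); an embedded level graph is a level graph with an embedding; vertices adjacent in a level's order are consecutive. Slope of $(u,v)$: $\Gamma(v)-\Gamma(u)$. A $\lambda$-drawing is a straight-line level-planar drawing inducing the given embedding with all slopes in $\{0,\dots,\lambda-1\}$. Standing convention: $\mathcal G$ contains a left boundary path $p_L$ and right boundary path $p_R$, each a directed path with one vertex on each level $1,\dots,k$, leftmost resp. rightmost on their levels; $n=|V|$; $v_R$ is the level-1 vertex of $p_R$. A circulation in a flow network with demands $d$ and capacities $c$ is an integer $\varphi\ge0$ with $d(a)\le\varphi(a)\le c(a)$ on every arc and flow conservation at every node. $F_{\mathcal G}^\lambda$: add to a level-planar drawing of $\mathcal G$ a horizontal segment between each two consecutive vertices of each level, giving a plane graph $\mathcal G'$. Nodes: one per bounded face of $\mathcal G'$, plus $s$ (outside region right of $p_R$ and below level 1) and $t$ (outside region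 left of $p_L$ and above level $k$). Arcs: for each edge $e=(u,w)$ a slope arc $e^\star$ from the region right of $e$ to the region left of $e$, demand $0$, capacity $\lambda-1$; for each consecutive pair $u,v$ ($u$ left of $v$) a space arc $[u,v]^\star$ from the region below segment $uv$ to the region above, demand $1$, capacity $(\lambda-1)(n-1)$; an arc $(t,s)$, demand $0$, unlimited capacity. For arcs define $f_L,f_R$: for $e^\star$, $e=(u,w)$: $f_L=u,f_R=w$; for $[u,v]^\star$: $f_L=u,f_R=v$; for $(t,s)$: $f_L$ = level-1 vertex of $p_L$, $f_R$ = level-$k$ vertex of $p_R$. For $x:V\to\mathbb Z$, $x^\star(a)=x(f_R(a))-x(f_L(a))$. For a circulation $\varphi$, $\varphi^\star:V\to\mathbb Z$: $\varphi^\star(v_R)=0$; along $p_R$ by increasing level $\varphi^\star(v)=\varphi^\star(u)+\varphi((u,v)^\star)$ for edges $(u,v)$ of $p_R$; for consecutive $w,x$ with $w$ left of $x$ and $\varphi^\star(x)$ known, $\varphi^\star(w)=\varphi^\star(x)+\varphi([w,x]^\star)$.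
   Formalization: λ-drawings have integer coordinates with x(v_R)=0; φ*(w)=φ*(x)−φ([w,x]* ) replaces the + sign; the bijection with all λ-drawings is for connected G, and for arbitrary G it is with λ-drawings whose consecutive gaps are at most (λ−1)(n−1). *)

(* Defs.v *)
From HB Require Import structures.
From mathcomp Require Import all_boot all_order all_algebra.
From mathcomp Require Import all_classical all_reals all_analysis.
Set Implicit Arguments.
Unset Strict Implicit.
Unset Printing Implicit Defensive.
Import Order.TTheory GRing.Theory Num.Theory.
Import numFieldNormedType.Exports.
Local Open Scope classical_set_scope.
Local Open Scope ring_scope.

(* [left_of] carries the embedding: [left_of u v] says that u and v lie on the
   same level and u precedes v there.  No order axioms are imposed; they follow
   from [induces_embedding] for any level-planar drawing. *)
Record embedded_proper_level_graph (k : nat) := EmbeddedProperLevelGraph {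
  vertex :> finType;
  edge : rel vertex;
  level : vertex -> nat;
  left_of : rel vertex;
  level_range : forall v, (1 <= level v <= k)%N;
  edge_proper : forall u v, edge u v -> level v = (level u).+1 }.

Section Embedding.
Context (k : nat) (G : embedded_proper_level_graph k).

Definition consecutive (u v : G) : bool :=
  left_of u v && [forall w, ~~ (left_of u w && left_of w v)].

(* Only the values p 1, ..., p k are meaningful. *)
Definition level_path (p : nat -> G) : Prop :=
  (forall i, (1 <= i <= k)%N -> level (p i) = i) /\
  (forall i, (1 <= i < k)%N -> edge (p i) (p i.+1)).

Definition left_boundary (p : nat -> G) : Prop :=
  level_path p /\ forall v : G, ~~ left_of v (p (level v)).

Definition right_boundary (p : nat -> G) : Prop :=
  level_path p /\ forall v : G, ~~ left_of (p (level v)) v.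

Definition graph_connected : Prop :=
  forall u v : G, connect (fun a b : G => edge a b || edge b a) u v.

End Embedding.

Section Drawing.
Context (R : realType) (k : nat) (G : embedded_proper_level_graph k).

(* A strictly y-monotone curve is the graph of a function of the height:
   the curve of the edge (u, w) is y |-> (curve u w y, y), where y ranges over
   [level u, level w]. *)
Record drawing := Drawing {
  xcoord : G -> R;
  curve : G -> G -> R -> R }.

Implicit Type D : drawing.

Definition height (v : G) : R := (level v)%:R.

Definition is_level_drawing D : Prop :=
  forall u w : G, edge u w ->
    [/\ {within `[height u, height w], continuous (curve D u w)},
        curve D u w (height u) = xcoord D u &
        curve D u w (height w) = xcoord D w].

(* For a proper graph an edge can meet a vertex only at the level of one of its
   end vertices, so injectivity on each level also prevents edges from passing
   through vertices. *)
Definition level_planar D : Prop :=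
  [/\ is_level_drawing D,
      (forall u v : G, level u = level v -> xcoord D u = xcoord D v -> u = v) &
      (forall (u w u' w' : G) (y : R),
          edge u w -> edge u' w' -> (u, w) <> (u', w') ->
          height u <= y <= height w -> height u' <= y <= height w' ->
          curve D u w y = curve D u' w' y ->
          exists v : G,
            [/\ v \in [:: u; w], v \in [:: u'; w'] & y = height v])].

Definition induces_embedding D : Prop :=
  forall u v : G,
    left_of u v = (level u == level v) && (xcoord D u < xcoord D v).

Definition slope (x : {ffun G -> int}) (u w : G) : int := x w - x u.

(* The rise of an edge of a proper graph is 1, so this is the segment from
   (x u, level u) to (x w, level w). *)
Definition straight_line (x : {ffun G -> int}) : drawing :=
  Drawing (fun v => (x v)%:~R)
          (fun u w y => (x u)%:~R + (y - height u) * (slope x u w)%:~R).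

Definition lambda_drawing (lambda : nat) (x : {ffun G -> int}) : Prop :=
  [/\ level_planar (straight_line x),
      induces_embedding (straight_line x) &
      forall u w : G, edge u w -> 0 <= slope x u w <= lambda%:Z - 1].

(* The drawing of G', i.e. D plus the segments between consecutive vertices. *)
Definition augmented_drawing D : set (R * R) :=
  [set p | exists v : G, p = (xcoord D v, height v)] `|`
  [set p | exists u w : G,
      [/\ edge u w, height u <= p.2 <= height w & p.1 = curve D u w p.2]] `|`
  [set p | exists u v : G,
      [/\ consecutive u v, p.2 = height u & xcoord D u <= p.1 <= xcoord D v]].

Definition region D (p : R * R) : set (R * R) :=
  connected_component (~` augmented_drawing D) p.

Definition is_face D (C : set (R * R)) : Prop :=
  exists2 p, ~ augmented_drawing D p & C = region D p.

(* The face incident to a side of a curve: the points lying in the region of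
   every point close enough, on that side, to any interior point of the curve. *)
Definition region_right D (u w : G) : set (R * R) :=
  [set q | forall y, height u < y < height w ->
     \forall d \near 0^'+, region D (curve D u w y + d, y) q].

Definition region_left D (u w : G) : set (R * R) :=
  [set q | forall y, height u < y < height w ->
     \forall d \near 0^'+, region D (curve D u w y - d, y) q].

Definition region_above D (u v : G) : set (R * R) :=
  [set q | forall x, xcoord D u < x < xcoord D v ->
     \forall d \near 0^'+, region D (x, height u + d) q].

Definition region_below D (u v : G) : set (R * R) :=
  [set q | forall x, xcoord D u < x < xcoord D v ->
     \forall d \near 0^'+, region D (x, height u - d) q].

End Drawing.

Record flow_network := FlowNetwork {
  node_type : Type;
  nodes : set node_type;
  arc : finType;
  tail : arc -> node_type;
  head : arc -> node_type;
  demand : arc -> int;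
  capacity : arc -> option int (* None: unlimited *) }.

Definition circulation (F : flow_network) (phi : {ffun arc F -> int}) : Prop :=
  [/\ forall a, 0 <= phi a,
      forall a, demand a <= phi a,
      forall a c, capacity a = Some c -> phi a <= c &
      forall v, @nodes F v ->
        \sum_(a | `[< head a = v >]) phi a = \sum_(a | `[< tail a = v >]) phi a].

Section FlowNetwork.
Context (R : realType) (k : nat) (G : embedded_proper_level_graph k).

Inductive face_node := FaceNode of set (R * R) | NodeS | NodeT.

Definition edge_pair := {e : G * G | edge e.1 e.2}.
Definition space_pair := {e : G * G | consecutive e.1 e.2}.

Definition flow_arc : finType := (edge_pair + space_pair + unit)%type.
Definition slope_arc (e : edge_pair) : flow_arc := inl (inl e).
Definition space_arc (g : space_pair) : flow_arc := inl (inr g).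
Definition ts_arc : flow_arc := inr tt.

(* The unbounded face is split into s and t.  It lies to the right of an edge
   only along p_R and below a segment only on level 1, where it stands for s;
   it lies to the left of an edge only along p_L and above a segment only on
   level k, where it stands for t. *)
Definition node_of (outer : face_node) (C : set (R * R)) : face_node :=
  if `[< bounded_set C >] then FaceNode C else outer.

Definition arc_tail (D : drawing R G) (a : flow_arc) : face_node :=
  match a with
  | inl (inl e) => node_of NodeS (region_right D (val e).1 (val e).2)
  | inl (inr g) => node_of NodeS (region_below D (val g).1 (val g).2)
  | inr _ => NodeT
  end.

Definition arc_head (D : drawing R G) (a : flow_arc) : face_node :=
  match a with
  | inl (inl e) => node_of NodeT (region_left D (val e).1 (val e).2)
  | inl (inr g) => node_of NodeT (region_above D (val g).1 (val g).2)
  | inr _ => NodeS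
  end.

Definition arc_demand (a : flow_arc) : int :=
  if a is inl (inr _) then 1 else 0.

Definition space_capacity (lambda : nat) : int :=
  (lambda%:Z - 1) * (#|G|%:Z - 1).

Definition arc_capacity (lambda : nat) (a : flow_arc) : option int :=
  match a with
  | inl (inl _) => Some (lambda%:Z - 1)
  | inl (inr _) => Some (space_capacity lambda)
  | inr _ => None
  end.

Definition face_nodes (D : drawing R G) : set face_node :=
  [set v | match v with
           | FaceNode C => is_face D C /\ bounded_set C
           | _ => True
           end].

Definition lambda_network (D : drawing R G) (lambda : nat) : flow_network :=
  FlowNetwork (face_nodes D) (arc_tail D) (arc_head D)
              arc_demand (arc_capacity lambda).

Context (pL pR : nat -> G).

Definition f_L (a : flow_arc) : G :=
  match a with
  | inl (inl e) => (val e).1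
  | inl (inr g) => (val g).1
  | inr _ => pL 1%N
  end.

Definition f_R (a : flow_arc) : G :=
  match a with
  | inl (inl e) => (val e).2
  | inl (inr g) => (val g).2
  | inr _ => pR k
  end.

Definition flow_of_coord (x : {ffun G -> int}) : {ffun flow_arc -> int} :=
  [ffun a => x (f_R a) - x (f_L a)].

Implicit Type phi : {ffun flow_arc -> int}.

(* The flow on (u, w)^*, resp. [u, v]^*, with 0 as a dummy value when the arc
   does not exist. *)
Definition slope_flow phi (u w : G) : int :=
  if insub (u, w) is Some e then phi (slope_arc e) else 0.
Definition space_flow phi (u v : G) : int :=
  if insub (u, v) is Some g then phi (space_arc g) else 0.

(* [boundary_coord phi i] is the coordinate of the vertex of p_R on level
   i + 1. *)
Fixpoint boundary_coord phi (i : nat) : int :=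
  if i is i'.+1 then
    boundary_coord phi i' + slope_flow phi (pR i'.+1) (pR i'.+2)
  else 0.

(* Coordinates increase to the right, hence the subtraction.  The first argument
   bounds the number of steps to the right needed to reach p_R; #|G| suffices. *)
Fixpoint coord_rec (m : nat) phi (w : G) : int :=
  if m is m'.+1 then
    if [pick x | consecutive w x] is Some x then
      coord_rec m' phi x - space_flow phi w x
    else boundary_coord phi (level w).-1
  else 0.

Definition coord_of_flow phi : {ffun G -> int} :=
  [ffun v => coord_rec #|G| phi v].

End FlowNetwork.

Definition mutually_inverse_bijections (T U : Type) (A : set T) (B : set U)
    (f : T -> U) (g : U -> T) : Prop :=
  [/\ set_bij A B f, set_bij B A g, {in A, cancel f g} & {in B, cancel g f}].

(* Main.v *)
(* Between two consecutive levels the edges are totally ordered from left to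
   right: by the intermediate value theorem two curves that exchanged their order
   would cross.  Hence the bounded faces of G' are exactly the open regions
   between two consecutive edges of a strip, and for the unbounded face it is
   enough to find an unbounded connected set on the relevant side of an arc.
   For a flow that agrees with [x^*] on the space arcs, the sums over the space
   arcs below and above such a face telescope, so conservation there says that
   the flow agrees with [x^*] on the left edge iff it does on the right edge.
   Starting from p_R, conservation therefore amounts to [phi = x^*], the arc
   (t, s) being determined by conservation at s.  Demands make [x] strictly
   increasing on every level, and since edges are never inverted, the
   straight-line drawing is planar. *)
Require Import Defs.
From HB Require Import structures.
From mathcomp Require Import all_boot all_order all_algebra.
From mathcomp Require Import all_classical all_reals all_analysis.
From mathcomp Require Import ring lra zify.
Set Implicit Arguments.
Unset Strict Implicit.
Unset Printing Implicit Defensive.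
Import Order.TTheory GRing.Theory Num.Theory.
Import numFieldNormedType.Exports.
Local Open Scope classical_set_scope.
Local Open Scope ring_scope.

(** * Regions bounded by two graphs *)

(** Faces are connected components and the curves of [D] are arbitrary, so which node an arc leaves
    or enters is a topological statement; once these incidences are known, only finite sums remain.
    What passes from [D] to the integer coordinates is the order of the vertices on a level and of
    the edges in a strip: a drawing in the bijection shares the embedding of [D], not its curves.

    Differences of coordinates are invariant under translation, whereas [coord_of_flow] puts the
    level-1 vertex of [pR] at 0; this is the origin of the normalisation [x (pR 1) = 0]. The
    capacity of the space arcs is an obstacle of its own: slopes alone do not bound the distance
    between different components, so a gap may exceed it. The bijection is therefore first stated
    for drawings whose gaps respect the capacity, and connectedness then yields this bound for every
    drawing: $n-1$ bounds the number of edges of a simple path, and $\lambda-1$ the change along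
    each edge. *)

Section Topology.
Context (R : realType).
Implicit Types (a b x y : R) (f g m : R -> R).

Definition clamp a b y := Num.min b (Num.max a y).

Lemma clamp_itv a b y : a <= b -> a <= clamp a b y <= b.
Proof. by move=> ab; rewrite /clamp le_min ge_min lexx ab le_max lexx. Qed.

Lemma clamp_id a b y : a <= y <= b -> clamp a b y = y.
Proof. by case/andP=> ay yb; rewrite /clamp max_r// min_r. Qed.

Lemma continuous_clamp a b f : a <= b -> {within `[a, b], continuous f} ->
  continuous (fun y => f (clamp a b y)).
Proof.
move=> ab cf y.
have cK : continuous (clamp a b).
  move=> z; apply: continuous_min; first exact: cvg_cst.
  by apply: continuous_max; [exact: cvg_cst|exact: cvg_id].
have inab z : `[a, b]%classic (clamp a b z) by rewrite /= in_itv/= clamp_itv.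
move/subspace_continuousP : cf => /(_ _ (inab y)) cf.
move=> A /cf; rewrite /= !nbhs_simpl /= /within/= => A'.
have := cK y _ A'; rewrite /= nbhs_simpl/=.
by apply: filterS => z Az; exact: (Az (inab z)).
Qed.

Lemma continuous_pair f g : continuous f -> continuous g ->
  continuous (fun y => (f y, g y) : R * R).
Proof.
move=> cf cg y.
exact: (@cvg_pair _ _ _ (nbhs y) (nbhs (f y)) (nbhs (g y))
  _ _ _ f g (cf y) (cg y)).
Qed.

Lemma connected_image (A : set R) (h : R -> R * R) :
  is_interval A -> continuous h -> connected (h @` A).
Proof.
move=> /connected_intervalP cA ch.
apply: connected_continuous_connected => //.
exact: continuous_subspaceT.
Qed.

(* Every horizontal slice is joined to the graph of [m]. *)
Lemma connected_slices (I : set R) (J : R -> set R) m :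
  is_interval I -> (forall y, I y -> is_interval (J y)) -> continuous m ->
  (forall y, I y -> J y (m y)) ->
  connected [set p : R * R | I p.2 /\ J p.2 p.1].
Proof.
move=> Iitv Jitv cm Jm.
have [[y0 Iy0]|/set0P/negP/negPn/eqP I0] := pselect (I !=set0); last first.
  rewrite (_ : [set _ | _] = set0) ?I0; first exact: connected0.
  by apply/seteqP; split=> // p [].
set gm := (fun y => (m y, y)) @` I.
set sl := fun y => (fun x => (x, y)) @` (J y).
have -> : [set p : R * R | I p.2 /\ J p.2 p.1] = \bigcup_(y in I) (gm `|` sl y).
  apply/seteqP; split=> [[x y] [/= Iy Jx]|p [y Iy [[z Iz <-]|[x Jx <-]]]].
  - by exists y => //; right; exists x.
  - by split=> //; exact: Jm.
  - by split.
apply: bigcup_connected.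
  by exists (m y0, y0) => y Iy; left; exists y0.
move=> y Iy; apply: connectedU.
- by exists (m y, y); split; [exists y|exists (m y) => //; exact: Jm].
- by apply: connected_image => //; apply: continuous_pair => // z; exact: cvg_id.
- apply: connected_image; first exact: Jitv.
  by apply: continuous_pair => z; [exact: cvg_id|exact: cvg_cst].
Qed.

(** The intersection of [A] with [S] equals its intersection with the open [U] and with the closed
    [C], so it is a nonempty clopen part of the connected [A]. For a face, [S = U] is an open cell
    and [C] the closed one; what has to be checked is that [A] avoids the boundary. *)
Lemma connected_trapped (T : topologicalType) (A S U C : set T) (p : T) :
  connected A -> open U -> closed C ->
  A `&` U `<=` S -> A `&` C `<=` S -> S `<=` U `&` C ->
  A p -> S p -> A `<=` S.
Proof.
move=> cA oU cC AU AC SUC Ap Sp.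
suff <- : A `&` S = A by move=> x [].
apply: cA; first by exists p.
- exists U => //; apply/seteqP; split=> x [Ax].
    by move=> /SUC[].
  by move=> Ux; split=> //; exact: AU.
- exists C => //; apply/seteqP; split=> x [Ax].
    by move=> /SUC[].
  by move=> Ux; split=> //; exact: AC.
Qed.

Definition cell a b f g : set (R * R) :=
  [set p | a < p.2 < b /\ f p.2 < p.1 < g p.2].

Definition closed_cell a b f g : set (R * R) :=
  [set p | a <= p.2 <= b /\ f p.2 <= p.1 <= g p.2].

Lemma continuous_snd_comp f : continuous f -> continuous (fun p : R * R => f p.2).
Proof.
move=> cf p; apply: continuous_comp; [exact: cvg_snd|exact: cf].
Qed.

Lemma open_cell a b f g : continuous f -> continuous g -> open (cell a b f g).
Proof.
move=> /continuous_snd_comp cf /continuous_snd_comp cg.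
have pos (h : R * R -> R) : continuous h -> open [set p | 0 < h p].
  move=> ch; rewrite (_ : [set _ | _] = h @^-1` [set z | 0 < z])//.
  by apply: open_comp => [p _|]; [exact: ch|exact: open_gt].
have cst (c : R) : continuous (fun _ : R * R => c) by exact: cst_continuous.
have c1 : continuous (@fst R R) by move=> p; exact: cvg_fst.
have c2 : continuous (@snd R R) by move=> p; exact: cvg_snd.
have -> : cell a b f g =
    ([set p | 0 < p.2 - a] `&` [set p | 0 < b - p.2]) `&`
    ([set p | 0 < p.1 - f p.2] `&` [set p | 0 < g p.2 - p.1]).
  apply/seteqP; split=> p.
    by move=> [/andP[? ?] /andP[? ?]]; do !split; rewrite /= subr_gt0.
  move=> [[/= + +] [/= + +]]; rewrite !subr_gt0 => ? ? ? ?.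
  by split; apply/andP.
by apply: openI; apply: openI; apply: pos => p; apply: continuousB;
  (exact: c1 || exact: c2 || exact: cst || exact: cf || exact: cg).
Qed.

Lemma closed_closed_cell a b f g :
  continuous f -> continuous g -> closed (closed_cell a b f g).
Proof.
move=> /continuous_snd_comp cf /continuous_snd_comp cg.
have pos (h : R * R -> R) : continuous h -> closed [set p | 0 <= h p].
  move=> ch; rewrite (_ : [set _ | _] = h @^-1` [set z | 0 <= z])//.
  by apply: preimage_closed => [p _|]; [exact: ch|exact: closed_ge].
have cst (c : R) : continuous (fun _ : R * R => c) by exact: cst_continuous.
have c1 : continuous (@fst R R) by move=> p; exact: cvg_fst.
have c2 : continuous (@snd R R) by move=> p; exact: cvg_snd.
have -> : closed_cell a b f g =
    ([set p | 0 <= p.2 - a] `&` [set p | 0 <= b - p.2]) `&`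
    ([set p | 0 <= p.1 - f p.2] `&` [set p | 0 <= g p.2 - p.1]).
  apply/seteqP; split=> p.
    by move=> [/andP[? ?] /andP[? ?]]; do !split; rewrite /= subr_ge0.
  move=> [[/= + +] [/= + +]]; rewrite !subr_ge0 => ? ? ? ?.
  by split; apply/andP.
by apply: closedI; apply: closedI; apply: pos => p; apply: continuousB;
  (exact: c1 || exact: c2 || exact: cst || exact: cf || exact: cg).
Qed.

Lemma is_interval_oo a b : is_interval [set y | a < y < b].
Proof.
move=> x y /= /andP[ax _] /andP[_ yb] z /andP[xz zy].
by rewrite (lt_le_trans ax xz) (le_lt_trans zy yb).
Qed.

Lemma is_interval_gt a : is_interval [set y | a < y].
Proof. by move=> x y /= ax _ z /andP[xz _]; exact: lt_le_trans xz. Qed.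

Lemma is_interval_lt a : is_interval [set y | y < a].
Proof. by move=> x y /= _ ya z /andP[_ zy]; exact: le_lt_trans ya. Qed.

Lemma connected_cell a b f g : continuous f -> continuous g ->
  (forall y, a < y < b -> f y < g y) -> connected (cell a b f g).
Proof.
move=> cf cg fg.
(* The midline of the two graphs is the spine that meets every slice. *)
apply: (@connected_slices [set y | a < y < b] (fun y => [set x | f y < x < g y])
  (fun y => (f y + g y) / 2)).
- exact: is_interval_oo.
- by move=> y _; exact: is_interval_oo.
- move=> y; apply: cvgM; last exact: cvg_cst.
  by apply: cvgD; [exact: cf|exact: cg].
- by move=> y /fg /= fgy; apply/andP; split; lra.
Qed.

Lemma bounded_cell a b f g : a <= b -> continuous f -> continuous g ->
  bounded_set (cell a b f g).
Proof.
move=> ab cf cg.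
have [u uab fu] := @EVT_min R f a b ab (continuous_subspaceT cf).
have [v vab gv] := @EVT_max R g a b ab (continuous_subspaceT cg).
exists (`|f u| + `|g v| + `|a| + `|b|); split; first exact: num_real.
move=> M ltM [x y] [/= /andP[ay yb] /andP[fx xg]].
have yab : y \in `[a, b] by rewrite in_itv/= !ltW.
have := fu _ yab; have := gv _ yab => gy fy.
have n1 := ler_norm (g v); have n2 := ler_norm (- f u).
have n3 := ler_norm b; have n4 := ler_norm (- a).
rewrite !normrN in n2 n4.
have p1 := normr_ge0 (g v); have p2 := normr_ge0 (f u).
have p3 := normr_ge0 b; have p4 := normr_ge0 a.
rewrite prod_normE/= ge_max !ler_norml; apply/andP; split; apply/andP; split; lra.
Qed.

Lemma unbounded_ray (S : set (R * R)) (h : R -> R * R) :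
  (forall t, 0 < t -> S (h t) /\ t <= `|h t|) -> ~ bounded_set S.
Proof.
move=> Sh [M0 [_ /(_ (Num.max M0 0 + 1)) bS]].
have M1 : M0 < Num.max M0 0 + 1 by rewrite ltr_pwDr// le_max lexx.
have M2 : 0 <= Num.max M0 0 by rewrite le_max lexx orbT.
have t0 : 0 < Num.max M0 0 + 2 by lra.
have [St let_] := Sh _ t0.
by have := le_trans let_ (bS M1 _ St) => /=; lra.
Qed.

Lemma near_right_fun_lt f g (l m : R) : f d @[d --> 0^'+] --> l ->
  g d @[d --> 0^'+] --> m -> l < m -> \forall d \near 0^'+, f d < g d.
Proof.
move=> fl gm lm.
have h : (g d - f d) @[d --> 0^'+] --> m - l by exact: cvgB.
move/cvgr_gt : h => /(_ 0); rewrite subr_gt0 => /(_ lm).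
by apply: filterS => d; rewrite subr_gt0.
Qed.

End Topology.

(** * Faces of a level-planar drawing *)

Section Faces.
Context (R : realType) (k : nat) (G : embedded_proper_level_graph k).
Context (D : drawing R G).
Hypotheses (hplanar : level_planar D) (hembed : induces_embedding D).

Let X := xcoord D.

(** * The left-to-right order of the edges in a strip *)

Definition tl (e : edge_pair G) : G := (val e).1.
Definition hd (e : edge_pair G) : G := (val e).2.
Definition lv (e : edge_pair G) : nat := level (tl e).

Lemma edge_tl_hd e : edge (tl e) (hd e). Proof. exact: (valP e). Qed.

Lemma level_hd e : level (hd e) = (lv e).+1.
Proof. exact/edge_proper/edge_tl_hd. Qed.

Lemma edge_pair_inj e e' : tl e = tl e' -> hd e = hd e' -> e = e'.
Proof.
by move: e e' => [[u w] uw] [[u' w'] uw'] /= uu ww; apply: val_inj; congr pair.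
Qed.

Lemma xcoord_inj u v : level u = level v -> X u = X v -> u = v.
Proof. by case: hplanar => _ + _; exact. Qed.

Lemma left_ofE u v : left_of u v = (level u == level v) && (X u < X v).
Proof. exact: hembed. Qed.

Lemma consecutiveP (u v : G) : reflect
  [/\ level u = level v, X u < X v &
      forall w, level w = level u -> X w <= X u \/ X v <= X w]
  (consecutive u v).
Proof.
apply: (iffP andP); rewrite left_ofE.
  move=> [/andP[/eqP uv ltuv] /forallP H]; split=> // w wu.
  have := H w; rewrite !left_ofE wu uv eqxx/= negb_and -!leNgt.
  by case/orP; [left|right].
move=> [uv ltuv H]; split; first by rewrite uv eqxx.
apply/forallP => w; rewrite !left_ofE.
have [wu|//] := eqVneq (level w) (level u).
by rewrite wu uv eqxx/= negb_and -!leNgt; apply/orP; exact: H.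
Qed.

(** The curve is continued by constants beyond its strip, so that it is continuous on all of [R] and
    needs no subspace topology. *)
Definition trace (e : edge_pair G) (y : R) : R :=
  curve D (tl e) (hd e) (clamp (lv e)%:R (lv e).+1%:R y).

Let ler_lv e : (lv e)%:R <= (lv e).+1%:R :> R. Proof. by rewrite ler_nat leqnSn. Qed.

Lemma continuous_trace e : continuous (trace e).
Proof.
case: hplanar => /(_ _ _ (edge_tl_hd e)) [+ _ _] _ _.
by rewrite /height level_hd => /(continuous_clamp (ler_lv e)).
Qed.

Lemma trace_curve e y : (lv e)%:R <= y <= (lv e).+1%:R ->
  trace e y = curve D (tl e) (hd e) y.
Proof. by move=> ?; rewrite /trace clamp_id. Qed.

Lemma trace_tl e : trace e (lv e)%:R = X (tl e).
Proof.
rewrite trace_curve ?lexx ?ler_lv//.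
by case: hplanar => /(_ _ _ (edge_tl_hd e)) [_ + _] _ _.
Qed.

Lemma trace_hd e : trace e (lv e).+1%:R = X (hd e).
Proof.
rewrite trace_curve ?lexx ?ler_lv//.
case: hplanar => /(_ _ _ (edge_tl_hd e)) [_ _ +] _ _.
by rewrite /height level_hd.
Qed.

(** By planarity two distinct edges meet only at a common end vertex, and its height is one of the
    two levels that bound the strip. *)
Lemma trace_inj e e' y : lv e = lv e' -> (lv e)%:R < y < (lv e).+1%:R ->
  trace e y = trace e' y -> e = e'.
Proof.
move=> ee' /andP[y0 y1] tt'; have [//|ne] := eqVneq e e'; exfalso.
have yy : (lv e)%:R <= y <= (lv e).+1%:R by rewrite !ltW.
have [_ _ /(_ _ _ _ _ y (edge_tl_hd e) (edge_tl_hd e'))] := hplanar.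
have: (tl e, hd e) <> (tl e', hd e').
  by move=> [ut uh]; case/negP: ne; apply/eqP; exact: edge_pair_inj.
rewrite /height !level_hd -!ee' -/(lv e) -/(lv e') -ee'.
move=> h1 /(_ h1 yy yy); rewrite -!trace_curve -?ee'// => /(_ tt') [v [+ _ yv]].
by rewrite !inE => /orP[] /eqP vE; move: y0 y1;
  rewrite yv vE ?level_hd -?/(lv e) !ltr_nat ?ltnn ?andbF.
Qed.

Definition mid (e : edge_pair G) : R := (lv e)%:R + 2^-1.

Lemma mid_itv e : (lv e)%:R < mid e < (lv e).+1%:R.
Proof. by rewrite /mid -[(lv e).+1%:R]natr1; apply/andP; split; lra. Qed.

(** The order is sampled at a single height; by [edge_ltE] every interior height of the strip gives
    the same order. *)
Definition edge_lt (e e' : edge_pair G) : bool :=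
  (lv e == lv e') && (trace e (mid e) < trace e' (mid e)).

Lemma edge_lt_lv e e' : edge_lt e e' -> lv e = lv e'.
Proof. by case/andP => /eqP. Qed.

Lemma edge_lt_irr e : edge_lt e e = false.
Proof. by rewrite /edge_lt ltxx andbF. Qed.

Lemma edge_lt_trans e f g : edge_lt e f -> edge_lt f g -> edge_lt e g.
Proof.
rewrite /edge_lt /mid => /andP[/eqP ef h] /andP[/eqP fg h'].
rewrite ef fg eqxx/= -fg; apply: lt_trans h'; by rewrite -ef.
Qed.

Lemma edge_lt_total e e' : lv e = lv e' -> e <> e' -> edge_lt e e' || edge_lt e' e.
Proof.
move=> ee' ne; rewrite /edge_lt /mid ee' eqxx/= -neq_lt; apply/eqP => tt'.
by apply: ne; apply: trace_inj tt' => //; rewrite -ee'; exact: mid_itv.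
Qed.

Lemma edge_lt_noninv e e' y : edge_lt e e' -> (lv e)%:R <= y <= (lv e).+1%:R ->
  ~~ (trace e' y < trace e y).
Proof.
move=> /andP[/eqP ee' lt_mid] /andP[y0 y1]; apply/negP => lt_y.
have [m0 m1] := andP (mid_itv e).
pose h z := trace e' z - trace e z.
have ch : continuous h.
  by move=> z; apply: cvgB; exact: continuous_trace.
have hm : 0 < h (mid e) by rewrite subr_gt0.
have hy : h y < 0 by rewrite subr_lt0.
(* The zero must lie strictly inside the strip, since two curves may share an end vertex. It does:
   [mid e] is interior, and a zero on the bounding level could only be [y], where [h] is
   negative. *)
suff [z zi hz] : exists2 z, (lv e)%:R < z < (lv e).+1%:R & h z = 0.
  have ee : e = e'.
    apply: (trace_inj ee' zi); apply/eqP; rewrite eq_sym -subr_eq0.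
    by rewrite -/(h z) hz.
  by move: hm; rewrite /h ee subrr ltxx.
have [le_|le_] := leP (mid e) y.
  have [||z] := @IVT R h (mid e) y 0 le_; first exact: continuous_subspaceT.
    by rewrite ge_min le_max (ltW hm) (ltW hy) orbT.
  rewrite in_itv/= => /andP[zm zy] hz; exists z => //.
  rewrite (lt_le_trans m0 zm) /= lt_neqAle (le_trans zy y1) andbT.
  apply/eqP => z1; have zy' : z = y by apply/eqP; rewrite eq_le zy z1.
  by move: hy; rewrite -zy' hz ltxx.
have [||z] := @IVT R h y (mid e) 0 (ltW le_); first exact: continuous_subspaceT.
  by rewrite ge_min le_max (ltW hm) (ltW hy) orbT.
rewrite in_itv/= => /andP[zy zm] hz; exists z => //.
rewrite (le_lt_trans zm m1) andbT lt_neqAle (le_trans y0 zy) andbT.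
apply/eqP => z1; have zy' : z = y by apply/eqP; rewrite eq_le zy -z1 y0.
by move: hy; rewrite -zy' hz ltxx.
Qed.

Lemma edge_lt_le e e' y : edge_lt e e' -> (lv e)%:R <= y <= (lv e).+1%:R ->
  trace e y <= trace e' y.
Proof. by move=> ee' /(edge_lt_noninv ee'); rewrite -leNgt. Qed.

Lemma edge_lt_lt e e' y : edge_lt e e' -> (lv e)%:R < y < (lv e).+1%:R ->
  trace e y < trace e' y.
Proof.
move=> ee' yi; rewrite lt_neqAle edge_lt_le// ?andbT; last first.
  by case/andP: yi => /ltW -> /ltW ->.
apply/eqP => tt'; have := edge_lt_irr e.
by rewrite {2}(trace_inj (edge_lt_lv ee') yi tt') ee'.
Qed.

Lemma edge_ltE e e' y : lv e = lv e' -> (lv e)%:R < y < (lv e).+1%:R ->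
  edge_lt e e' = (trace e y < trace e' y).
Proof.
move=> ee' yi; apply/idP/idP => [/edge_lt_lt -> //|lt_].
have [eq_|/edge_lt_total] := pselect (e = e').
  by move: lt_; rewrite eq_ ltxx.
move=> /(_ ee') /orP[//|/edge_lt_lt]; rewrite -ee' => /(_ _ yi) /lt_trans.
by move=> /(_ _ lt_); rewrite ltxx.
Qed.

Lemma edge_lt_tl e e' : edge_lt e e' -> X (tl e) <= X (tl e').
Proof.
move=> ee'; rewrite -!trace_tl -(edge_lt_lv ee').
by apply: edge_lt_le; rewrite ?lexx ?ler_lv.
Qed.

Lemma edge_lt_hd e e' : edge_lt e e' -> X (hd e) <= X (hd e').
Proof.
move=> ee'; rewrite -!trace_hd -(edge_lt_lv ee').
by apply: edge_lt_le; rewrite ?lexx ?ler_lv.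
Qed.

Definition next_edge (e e' : edge_pair G) : bool :=
  edge_lt e e' && [forall f, ~~ (edge_lt e f && edge_lt f e')].

Lemma next_edge_lt e e' : next_edge e e' -> edge_lt e e'.
Proof. by case/andP. Qed.

Lemma next_edge_lv e e' : next_edge e e' -> lv e = lv e'.
Proof. by move/next_edge_lt/edge_lt_lv. Qed.

Lemma next_edge_gap e e' f : next_edge e e' -> ~~ (edge_lt e f && edge_lt f e').
Proof. by case/andP => _ /forallP. Qed.

Lemma next_edge_exists e f : edge_lt e f -> exists e', next_edge e e'.
Proof.
move=> ef; have [e' ee' min_e'] := @arg_minP _ _ _ f (edge_lt e)
  (fun g => trace g (mid e)) ef.
exists e'; rewrite /next_edge ee'; apply/forallP => g; apply/negP => /andP[eg ge'].
have /= := min_e' _ eg; rewrite leNgt -edge_ltE ?ge'//.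
  by rewrite -(edge_lt_lv eg) (edge_lt_lv ee').
by rewrite -(edge_lt_lv eg) mid_itv.
Qed.

Lemma prev_edge_exists e' f : edge_lt f e' -> exists e, next_edge e e'.
Proof.
move=> fe'; have [e ee' max_e] := @arg_maxP _ _ _ f (edge_lt^~ e')
  (fun g => trace g (mid e')) fe'.
exists e; rewrite /next_edge ee'; apply/forallP => g; apply/negP => /andP[eg ge'].
have /= := max_e _ ge'; rewrite leNgt -edge_ltE ?eg//.
  by rewrite (edge_lt_lv eg).
by rewrite (edge_lt_lv ee') mid_itv.
Qed.

Lemma next_edge_injr e f f' : next_edge e f -> next_edge e f' -> f = f'.
Proof.
move=> ef ef'; have [//|/edge_lt_total] := pselect (f = f').
rewrite -(next_edge_lv ef) -(next_edge_lv ef') => /(_ erefl) /orP[] ff'.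
  by have := next_edge_gap f ef'; rewrite ff' (next_edge_lt ef).
by have := next_edge_gap f' ef; rewrite ff' (next_edge_lt ef').
Qed.

(** * Cells between neighbouring edges are regions *)

Definition face (e e' : edge_pair G) : set (R * R) :=
  cell (lv e)%:R (lv e).+1%:R (trace e) (trace e').

(** The nearest vertices on the two sides of [x] are consecutive, so their segment contains the
    point. Hence no region can leave a strip between two vertices of the bounding level. *)
Lemma augmented_segment (u v : G) x : level u = level v -> X u <= x <= X v ->
  augmented_drawing D (x, height R u).
Proof.
move=> uv /andP[ux xv].
pose P w := (level w == level u) && (X w <= x).
pose Q w := (level w == level u) && (x <= X w).
have [a /andP[/eqP au ax] max_a] := @arg_maxP _ _ _ u P X (introT andP (conj (eqxx _) ux)).
have Qv : Q v by rewrite /Q uv eqxx.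
have [b /andP[/eqP bu xb] min_b] := @arg_minP _ _ _ v Q X Qv.
have [axe|axn] := eqVneq (X a) x.
  by left; left; exists a; rewrite /height au -/X axe.
have [bxe|bxn] := eqVneq (X b) x.
  by left; left; exists b; rewrite /height bu -/X bxe.
right; exists a, b; split; rewrite /= -/X ?ax ?xb ?/height ?au//.
apply/consecutiveP; split; first by rewrite au bu.
  by apply: lt_le_trans xb; rewrite lt_neqAle axn.
move=> w wa; have [wx|xw] := leP (X w) x.
  by left; apply: max_a; rewrite /P wa au eqxx.
by right; apply: min_b; rewrite /Q wa au eqxx ltW.
Qed.

Lemma strip_level (n m : nat) (y : R) : n%:R < y < n.+1%:R -> m%:R <= y <= m.+1%:R -> m = n.
Proof.
move=> /andP[ny yn] /andP[my ym]; apply/eqP; rewrite eqn_leq.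
have := le_lt_trans my yn; have := lt_le_trans ny ym; rewrite !ltr_nat !ltnS.
by move=> -> ->.
Qed.

Lemma strip_not_nat (n m : nat) (y : R) : n%:R < y < n.+1%:R -> y <> m%:R.
Proof. by move=> /andP[+ +] ym; rewrite ym !ltr_nat; lia. Qed.

Lemma not_augmented_strip (n : nat) (p : R * R) : n%:R < p.2 < n.+1%:R ->
  (forall e, lv e = n -> trace e p.2 <> p.1) -> ~ augmented_drawing D p.
Proof.
move=> pn ne [[|]|].
- by move=> [v pv]; apply: (strip_not_nat (m := level v) pn); rewrite pv.
- move=> [u [w [uw pi p1]]].
  pose e : edge_pair G := exist _ (u, w) uw.
  have pe : (lv e)%:R <= p.2 <= (lv e).+1%:R.
    by move: pi; rewrite /height -(level_hd e).
  by apply: (ne e); [exact: strip_level pn pe|rewrite trace_curve// p1].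
- by move=> [u [v [_ pu _]]]; exact: (strip_not_nat pn pu).
Qed.

Lemma face_not_augmented e e' : next_edge e e' -> face e e' `<=` ~` augmented_drawing D.
Proof.
move=> ee' p [pi /andP[ep pe']]; apply: (not_augmented_strip pi) => f fe fp.
have := next_edge_gap f ee'; rewrite (edge_ltE (y := p.2)) ?fe// fp ep/=.
by rewrite (edge_ltE (y := p.2)) ?fe ?(next_edge_lv ee')// -?(next_edge_lv ee')// fp pe'.
Qed.

Lemma connected_face e e' : next_edge e e' -> connected (face e e').
Proof.
move=> ee'; apply: connected_cell; try exact: continuous_trace.
by move=> y; apply: edge_lt_lt; exact: next_edge_lt.
Qed.

(** The cell is connected and avoids the drawing. Conversely its boundary consists of parts of two
    edges and of level segments, all drawn, so the component of [p] is trapped in the cell. *)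
Lemma region_face e e' p : next_edge e e' -> face e e' p -> region D p = face e e'.
Proof.
move=> ee' pf; apply/seteqP; split; last first.
  by apply: connected_component_max => //;
    [exact: face_not_augmented|exact: connected_face].
apply: (@connected_trapped _ _ (face e e') (face e e')
  (closed_cell (lv e)%:R (lv e).+1%:R (trace e) (trace e')) p) => //.
- exact: component_connected.
- by apply: open_cell; exact: continuous_trace.
- by apply: closed_closed_cell; exact: continuous_trace.
- move=> [x y] [/connected_component_sub nq [/= /andP[y0 y1] /andP[ex xe']]].
  have ee2 := next_edge_lv ee'.
  have n0 : (lv e)%:R != y.
    apply/eqP => yE; apply: nq; rewrite -yE.
    apply: (@augmented_segment (tl e) (tl e')); first exact: ee2.
    by rewrite -!trace_tl -ee2 yE ex.
  have n1 : y != (lv e).+1%:R.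
    apply/eqP => yE; apply: nq; rewrite yE -level_hd.
    apply: (@augmented_segment (hd e) (hd e')); first by rewrite !level_hd ee2.
    by rewrite -!trace_hd -ee2 -yE ex.
  split=> /=; first by rewrite !lt_neqAle n0 n1 y0 y1.
  have yi : (lv e)%:R <= y <= (lv e).+1%:R by rewrite y0.
  rewrite !lt_neqAle ex xe' !andbT; apply/andP; split; apply/eqP => tx; apply: nq.
    left; right; exists (tl e), (hd e); rewrite /height level_hd.
    by split; [exact: edge_tl_hd|exact: yi|rewrite -tx trace_curve].
  left; right; exists (tl e'), (hd e'); rewrite /height level_hd -/(lv e') -ee2.
  by split; [exact: edge_tl_hd|exact: yi|rewrite tx trace_curve -?ee2].
- move=> q [/andP[? ?] /andP[? ?]]; split; split=> //=; try by apply/andP.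
  + by apply/andP; split; apply: ltW.
  + by apply/andP; split; apply: ltW.
- by apply: connected_component_refl; exact: face_not_augmented pf.
Qed.

Lemma face_neq0 e e' y : next_edge e e' -> (lv e)%:R < y < (lv e).+1%:R ->
  face e e' ((trace e y + trace e' y) / 2, y).
Proof.
move=> ee' yi; split=> //=; have := edge_lt_lt (next_edge_lt ee') yi.
by move=> ?; apply/andP; split; lra.
Qed.

Lemma is_face_face e e' : next_edge e e' -> is_face D (face e e').
Proof.
move=> ee'; have pf := face_neq0 ee' (mid_itv e).
exists ((trace e (mid e) + trace e' (mid e)) / 2, mid e).
  exact: face_not_augmented pf.
by rewrite (region_face ee' pf).
Qed.

Lemma bounded_face e e' : bounded_set (face e e').
Proof. by apply: bounded_cell; [exact: ler_lv|exact: continuous_trace..]. Qed.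

(** A common point fixes the strip and gives [edge_lt f e'] and [edge_lt e f']. If [e] and [f]
    differed, one of them would lie strictly between the other and its successor. *)
Lemma face_inj e e' f f' : next_edge e e' -> next_edge f f' ->
  face e e' = face f f' -> e = f /\ e' = f'.
Proof.
move=> ee' ff' eqf; have pe := face_neq0 ee' (mid_itv e).
have := pe; rewrite eqf => -[/= mf /andP[fx xf']].
have [mf0 mf1] := andP mf.
case: pe => /= me /andP[ex xe'].
have lvf : lv f = lv e by apply: strip_level me _; rewrite !ltW.
suff fe : f = e by split=> //; move: ff'; rewrite fe => /(next_edge_injr ee').
have fe' : edge_lt f e'.
  by rewrite (edge_ltE (y := mid e)) ?lvf -?(next_edge_lv ee')// (lt_trans fx).
have ef' : edge_lt e f'.
  by rewrite (edge_ltE (y := mid e)) -?(next_edge_lv ff')// (lt_trans ex).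
have [//|/edge_lt_total] := pselect (f = e) => /(_ lvf)/orP[]lt_.
  by have := next_edge_gap e ff'; rewrite lt_ ef'.
by have := next_edge_gap f ee'; rewrite lt_ fe'.
Qed.

End Faces.

(** * The faces on the two sides of an arc *)

Section Sides.
Context (R : realType) (k : nat) (G : embedded_proper_level_graph k).
Context (D : drawing R G).
Hypotheses (hplanar : level_planar D) (hembed : induces_embedding D).

Let X := xcoord D.

(** [P] selects the interior parameters of an arc, and [h y d] is the point at distance [d] from it
    on the chosen side. One parameter must exist, as otherwise the set on the left would be the
    whole plane. *)
Lemma side_region_eq (P : R -> Prop) (h : R -> R -> R * R) (S : set (R * R)) :
  (forall p, S p -> region D p = S) ->
  (forall y, P y -> \forall d \near 0^'+, S (h y d)) ->
  (exists y, P y) ->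
  [set q | forall y, P y -> \forall d \near 0^'+, region D (h y d) q] = S.
Proof.
move=> regS nearS [y0 Py0]; apply/seteqP; split=> [q qP|q Sq y Py].
  have : \forall d \near 0^'+, region D (h y0 d) q /\ S (h y0 d).
    by apply: filterI; [exact: qP|exact: nearS].
  move=> /(@filter_ex _ _ (at_right_proper_filter 0)) [d [rq Sh]].
  by rewrite -(regS _ Sh).
by apply: filterS (nearS _ Py) => d /regS ->.
Qed.

Lemma side_region_sub (P : R -> Prop) (h : R -> R -> R * R) (S : set (R * R)) :
  S `<=` ~` augmented_drawing D -> connected S ->
  (forall y, P y -> \forall d \near 0^'+, S (h y d)) ->
  S `<=` [set q | forall y, P y -> \forall d \near 0^'+, region D (h y d) q].
Proof.
move=> SD cS nearS q Sq y Py; apply: filterS (nearS _ Py) => d Sh.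
exact: (connected_component_max Sh SD cS).
Qed.

Lemma region_right_face e e' : next_edge D e e' ->
  region_right D (tl e) (hd e) = face D e e'.
Proof.
move=> ee'; have lt_ := next_edge_lt ee'.
rewrite /region_right /height level_hd.
apply: (side_region_eq (P := fun y => (lv e)%:R < y < (lv e).+1%:R)
  (h := fun y d => (curve D (tl e) (hd e) y + d, y))).
- by move=> p; exact: region_face.
- move=> y yi; have te := edge_lt_lt hplanar lt_ yi.
  rewrite -subr_gt0 in te.
  near=> d; split=> //=.
  rewrite -trace_curve; last by rewrite !ltW//; case/andP: yi.
  apply/andP; split; first by rewrite ltrDl; near: d; exact: nbhs_right_gt.
  by rewrite -ltrBrDl; near: d; exact: nbhs_right_lt.
- by exists (mid R e); exact: mid_itv.
Unshelve. all: by end_near. Qed.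

Lemma region_left_face e e' : next_edge D e e' ->
  region_left D (tl e') (hd e') = face D e e'.
Proof.
move=> ee'; have lt_ := next_edge_lt ee'; have ee2 := next_edge_lv ee'.
rewrite /region_left /height level_hd -/(lv e') -ee2.
apply: (side_region_eq (P := fun y => (lv e)%:R < y < (lv e).+1%:R)
  (h := fun y d => (curve D (tl e') (hd e') y - d, y))).
- by move=> p; exact: region_face.
- move=> y yi; have te := edge_lt_lt hplanar lt_ yi.
  rewrite -subr_gt0 in te.
  near=> d; split=> //=.
  rewrite -trace_curve; last by rewrite -ee2 !ltW//; case/andP: yi.
  apply/andP; split; last by rewrite gtrBl; near: d; exact: nbhs_right_gt.
  by rewrite ltrBrDl -ltrBrDr; near: d; exact: nbhs_right_lt.
- by exists (mid R e); exact: mid_itv.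
Unshelve. all: by end_near. Qed.

Lemma trace_right e y s :
  trace D e (y + s * d) @[d --> 0^'+] --> trace D e y.
Proof.
apply: cvg_at_right_filter.
have -> : trace D e y = trace D e (y + s * 0) by rewrite mulr0 addr0.
apply: (@continuous_comp _ _ _ (fun d => y + s * d) (trace D e) 0).
  by apply: cvgD; [exact: cvg_cst|apply: cvgM; [exact: cvg_cst|exact: cvg_id]].
exact: continuous_trace.
Qed.

(* A point at distance [d] above ([s = 1]) or below ([s = -1]) the line
   [y = y0] that bounds the strip. *)
Lemma near_face e e' y0 s x :
  trace D e y0 < x < trace D e' y0 ->
  (\forall d \near 0^'+, (lv e)%:R < y0 + s * d < (lv e).+1%:R) ->
  \forall d \near 0^'+, face D e e' (x, y0 + s * d).
Proof.
move=> /andP[ex xe'] yi.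
have h1 := near_right_fun_lt (@trace_right e y0 s) (cvg_cst x) ex.
have h2 := near_right_fun_lt (cvg_cst x) (@trace_right e' y0 s) xe'.
near=> d; split=> /=; first by near: d.
by apply/andP; split; near: d; [exact: h1|exact: h2].
Unshelve. all: by end_near. Qed.

(** On the level line a point strictly between [a] and [b] lies strictly between the two traces, and
    by continuity it still does slightly above. *)
Lemma region_above_face e e' (a b : G) : next_edge D e e' -> level a = lv e ->
  X a < X b -> X (tl e) <= X a -> X b <= X (tl e') ->
  region_above D a b = face D e e'.
Proof.
move=> ee' la ab ea be'.
apply: (side_region_eq (P := fun x => X a < x < X b)
  (h := fun x d => (x, height R a + d))).
- by move=> p; exact: region_face.
- move=> x /andP[ax xb].
  suff : \forall d \near 0^'+, face D e e' (x, (lv e)%:R + 1 * d).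
    by rewrite /height la; apply: filterS => d; rewrite mul1r.
  apply: near_face.
    rewrite {2}(next_edge_lv ee') !trace_tl//.
    by rewrite (le_lt_trans ea ax) (lt_le_trans xb be').
  near=> d; rewrite mul1r ltrDl; apply/andP; split.
    by near: d; exact: nbhs_right_gt.
  by rewrite -natr1 ltrD2l; near: d; exact: nbhs_right_lt.
- by exists ((X a + X b) / 2); apply/andP; split; lra.
Unshelve. all: by end_near. Qed.

Lemma region_below_face e e' (a b : G) : next_edge D e e' -> level a = (lv e).+1 ->
  X a < X b -> X (hd e) <= X a -> X b <= X (hd e') ->
  region_below D a b = face D e e'.
Proof.
move=> ee' la ab ea be'.
apply: (side_region_eq (P := fun x => X a < x < X b)
  (h := fun x d => (x, height R a - d))).
- by move=> p; exact: region_face.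
- move=> x /andP[ax xb].
  suff : \forall d \near 0^'+, face D e e' (x, (lv e).+1%:R + -1 * d).
    by rewrite /height la; apply: filterS => d; rewrite mulN1r.
  apply: near_face.
    rewrite {2}(next_edge_lv ee') !trace_hd//.
    by rewrite (le_lt_trans ea ax) (lt_le_trans xb be').
  near=> d; rewrite mulN1r gtrBl; apply/andP; split; last first.
    by near: d; exact: nbhs_right_gt.
  by rewrite ltrBrDr -natr1 ltrD2l; near: d; exact: nbhs_right_lt.
- by exists ((X a + X b) / 2); apply/andP; split; lra.
Unshelve. all: by end_near. Qed.

Lemma unbounded_right e : (forall f, ~~ edge_lt D e f) ->
  ~ bounded_set (region_right D (tl e) (hd e)).
Proof.
move=> last_e.
pose S := [set p : R * R | (lv e)%:R < p.2 < (lv e).+1%:R /\ trace D e p.2 < p.1].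
suff SR : S `<=` region_right D (tl e) (hd e).
  apply: (@unbounded_ray _ _ (fun t => (`|trace D e (mid R e)| + t, mid R e))).
  (* The absolute value in the ray keeps it to the right of the curve and makes its norm at least
     [t]. *)
  move=> t t0; split.
    by apply: SR; split=> /=; [exact: mid_itv|exact: ltr_pwDr (ler_norm _)].
  rewrite prod_normE/= le_max; apply/orP; left.
  by rewrite ger0_norm ?lerDr// addr_ge0// ltW.
rewrite /region_right /height level_hd.
apply: (side_region_sub (P := fun y => (lv e)%:R < y < (lv e).+1%:R)
  (h := fun y d => (curve D (tl e) (hd e) y + d, y))).
- move=> p [pi ep]; apply: (not_augmented_strip pi) => f fe fp.
  have := last_e f; rewrite (edge_ltE hplanar (y := p.2)) ?fe// fp.
  by rewrite ep.
- apply: (@connected_slices _ [set y | (lv e)%:R < y < (lv e).+1%:R]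
    (fun y => [set x | trace D e y < x]) (fun y => trace D e y + 1)).
  + exact: is_interval_oo.
  + by move=> y _; exact: is_interval_gt.
  + by move=> y; apply: cvgD; [exact: continuous_trace|exact: cvg_cst].
  + by move=> y _ /=; rewrite ltrDl.
- move=> y yi; near=> d; split=> //=.
  rewrite -trace_curve; last by rewrite !ltW//; case/andP: yi.
  by rewrite ltrDl; near: d; exact: nbhs_right_gt.
Unshelve. all: by end_near. Qed.

Lemma unbounded_left e : (forall f, ~~ edge_lt D f e) ->
  ~ bounded_set (region_left D (tl e) (hd e)).
Proof.
move=> first_e.
pose S := [set p : R * R | (lv e)%:R < p.2 < (lv e).+1%:R /\ p.1 < trace D e p.2].
suff SR : S `<=` region_left D (tl e) (hd e).
  apply: (@unbounded_ray _ _ (fun t => (- `|trace D e (mid R e)| - t, mid R e))).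
  move=> t t0; split.
    apply: SR; split=> /=; first exact: mid_itv.
    have := ler_norm (- trace D e (mid R e)); rewrite normrN => ?; lra.
  rewrite prod_normE/= le_max; apply/orP; left.
  by rewrite -opprD normrN ger0_norm ?lerDr// addr_ge0// ltW.
rewrite /region_left /height level_hd.
apply: (side_region_sub (P := fun y => (lv e)%:R < y < (lv e).+1%:R)
  (h := fun y d => (curve D (tl e) (hd e) y - d, y))).
- move=> p [pi pe]; apply: (not_augmented_strip pi) => f fe fp.
  have := first_e f; rewrite (edge_ltE hplanar (y := p.2)) ?fe// fp.
  by rewrite pe.
- apply: (@connected_slices _ [set y | (lv e)%:R < y < (lv e).+1%:R]
    (fun y => [set x | x < trace D e y]) (fun y => trace D e y - 1)).
  + exact: is_interval_oo.
  + by move=> y _; exact: is_interval_lt.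
  + by move=> y; apply: cvgB; [exact: continuous_trace|exact: cvg_cst].
  + by move=> y _ /=; rewrite gtrBl.
- move=> y yi; near=> d; split=> //=.
  rewrite -trace_curve; last by rewrite !ltW//; case/andP: yi.
  by rewrite gtrBl; near: d; exact: nbhs_right_gt.
Unshelve. all: by end_near. Qed.

(** This leaves the half-planes below level 1 and above level [k] free, which serve as unbounded
    connected sets next to the extreme segments. *)
Lemma augmented_height p : augmented_drawing D p -> 1 <= p.2 <= k%:R.
Proof.
have hv v : 1 <= height R (v : G) <= k%:R.
  by rewrite /height ler1n ler_nat; exact: level_range.
case=> [[[v ->]|[u [w [_ /andP[up pw] _]]]]|[u [v [_ -> _]]]]; try exact: hv.
have [/andP[u1 _] /andP[_ wk]] := (hv u, hv w).
by rewrite (le_trans u1 up) (le_trans pw wk).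
Qed.

Lemma connected_halfplane (I : set R) : is_interval I ->
  connected [set p : R * R | I p.2].
Proof.
move=> itvI; rewrite (_ : [set _ | _] = [set p | I p.2 /\ setT p.1]); last first.
  by apply/seteqP; split=> p //= [].
apply: (connected_slices (J := fun=> setT) (m := fun=> 0)) => //.
by move=> ?; exact: cvg_cst.
Qed.

Lemma unbounded_below (a b : G) : level a = 1%N -> ~ bounded_set (region_below D a b).
Proof.
move=> la; pose S := [set p : R * R | p.2 < 1].
suff SR : S `<=` region_below D a b.
  apply: (@unbounded_ray _ _ (fun t => (t, 0))) => t t0.
  by split; [apply: SR; rewrite /S/=|rewrite prod_normE/= le_max ler_norm].
apply: (side_region_sub (P := fun x => X a < x < X b)
  (h := fun x d => (x, height R a - d))).
- by move=> p /= p1 /augmented_height /andP[+ _]; rewrite leNgt p1.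
- by apply: (connected_halfplane (I := [set y | y < 1])); exact: is_interval_lt.
- move=> x _; near=> d; rewrite /S/= /height la gtrBl.
  by near: d; exact: nbhs_right_gt.
Unshelve. all: by end_near. Qed.

Lemma unbounded_above (a b : G) : level a = k -> ~ bounded_set (region_above D a b).
Proof.
move=> la; pose S := [set p : R * R | k%:R < p.2].
suff SR : S `<=` region_above D a b.
  apply: (@unbounded_ray _ _ (fun t => (t, k.+1%:R))) => t t0.
  split; [apply: SR; rewrite /S/= ltr_nat//|rewrite prod_normE/= le_max ler_norm//].
apply: (side_region_sub (P := fun x => X a < x < X b)
  (h := fun x d => (x, height R a + d))).
- by move=> p /= pk /augmented_height /andP[_]; rewrite leNgt pk.
- by apply: (connected_halfplane (I := [set y | k%:R < y])); exact: is_interval_gt.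
- move=> x _; near=> d; rewrite /S/= /height la ltrDl.
  by near: d; exact: nbhs_right_gt.
Unshelve. all: by end_near. Qed.

(** * Boundary paths and the end nodes of the arcs *)

Context (pL pR : nat -> G) (hL : left_boundary pL) (hR : right_boundary pR).

Lemma boundary_le (v : G) : X (pL (level v)) <= X v <= X (pR (level v)).
Proof.
have [[lL _] /(_ v)] := hL; have [[lR _] /(_ v)] := hR.
rewrite !(left_ofE hembed) lL ?lR ?level_range// eqxx/= -!leNgt.
by move=> -> ->.
Qed.

Definition on_path (p : nat -> G) (e : edge_pair G) : bool :=
  (tl e == p (lv e)) && (hd e == p (lv e).+1).

Lemma lv_range e : (1 <= lv (e : edge_pair G) < k)%N.
Proof.
have := level_range (hd e); rewrite level_hd => /andP[_ ->].
by have /andP[->] := level_range (tl e).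
Qed.

Lemma path_edge p (n : nat) : level_path p -> (1 <= n < k)%N ->
  exists e : edge_pair G, [/\ lv e = n, tl e = p n & hd e = p n.+1].
Proof.
move=> [lp ep] nk; exists (exist _ (p n, p n.+1) (ep n nk)); split=> //.
by rewrite /lv /tl/= lp//; case/andP: nk => -> /ltnW.
Qed.

(** An edge to the right of a boundary edge has its ends weakly to the right, hence on the boundary
    vertices themselves, and an edge is determined by its ends. Conversely the boundary edge of the
    strip cannot lie left of a last edge. *)
Lemma last_edgeP e : reflect (forall f, ~~ edge_lt D e f) (on_path pR e).
Proof.
apply: (iffP idP) => [/andP[/eqP te /eqP he] f|last_e].
  apply/negP => ef; have ef' := edge_lt_lv ef.
  suff fe : f = e by move: ef; rewrite fe edge_lt_irr.
  apply: edge_pair_inj; apply: (xcoord_inj hplanar).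
  - by rewrite -!/(lv _).
  - apply/eqP; rewrite eq_le (edge_lt_tl hplanar ef) andbT te ef'.
    by case/andP: (boundary_le (tl f)).
  - by rewrite !level_hd ef'.
  - apply/eqP; rewrite eq_le (edge_lt_hd hplanar ef) andbT he ef' -level_hd.
    by case/andP: (boundary_le (hd f)).
have [f [fe tf hf]] := path_edge hR.1 (lv_range e).
suff ef : e = f by rewrite /on_path {1 3}ef tf hf !eqxx.
have [//|/(edge_lt_total hplanar)] := pselect (e = f) => /(_ (esym fe)).
rewrite (negPf (last_e f))/= => lt_fe; apply: edge_pair_inj; apply: (xcoord_inj hplanar).
- by rewrite -!/(lv _).
- apply/eqP; rewrite eq_le (edge_lt_tl hplanar lt_fe) andbT tf.
  by case/andP: (boundary_le (tl e)).
- by rewrite !level_hd fe.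
- apply/eqP; rewrite eq_le (edge_lt_hd hplanar lt_fe) andbT hf -level_hd.
  by case/andP: (boundary_le (hd e)).
Qed.

Lemma first_edgeP e : reflect (forall f, ~~ edge_lt D f e) (on_path pL e).
Proof.
apply: (iffP idP) => [/andP[/eqP te /eqP he] f|first_e].
  apply/negP => fe; have fe' := edge_lt_lv fe.
  suff ef : f = e by move: fe; rewrite ef edge_lt_irr.
  apply: edge_pair_inj; apply: (xcoord_inj hplanar).
  - by rewrite -!/(lv _).
  - apply/eqP; rewrite eq_le (edge_lt_tl hplanar fe) /= te -fe'.
    by case/andP: (boundary_le (tl f)).
  - by rewrite !level_hd fe'.
  - apply/eqP; rewrite eq_le (edge_lt_hd hplanar fe) /= he -fe' -level_hd.
    by case/andP: (boundary_le (hd f)).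
have [f [fe tf hf]] := path_edge hL.1 (lv_range e).
suff ef : e = f by rewrite /on_path {1 3}ef tf hf !eqxx.
have [//|/(edge_lt_total hplanar)] := pselect (e = f) => /(_ (esym fe)).
rewrite (negPf (first_e f)) orbF => ef; apply: edge_pair_inj; apply: (xcoord_inj hplanar).
- by rewrite -!/(lv _).
- apply/eqP; rewrite eq_le (edge_lt_tl hplanar ef) /= tf.
  by case/andP: (boundary_le (tl e)).
- by rewrite !level_hd fe.
- apply/eqP; rewrite eq_le (edge_lt_hd hplanar ef) /= hf -level_hd.
  by case/andP: (boundary_le (hd e)).
Qed.

Lemma next_or_last e : on_path pR e \/ exists e', next_edge D e e'.
Proof.
have [|/last_edgeP/existsNP[f /negP/negPn ef]] := boolP (on_path pR e); first by left.
by right; exact: next_edge_exists ef.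
Qed.

Lemma prev_or_first e : on_path pL e \/ exists e', next_edge D e' e.
Proof.
have [|/first_edgeP/existsNP[f /negP/negPn fe]] := boolP (on_path pL e); first by left.
by right; exact: prev_edge_exists fe.
Qed.

Lemma tail_slope_last e : on_path pR e -> arc_tail D (slope_arc e) = NodeS R.
Proof.
by move=> /last_edgeP /unbounded_right nb; rewrite /arc_tail/= /node_of asboolF.
Qed.

Lemma head_slope_first e : on_path pL e -> arc_head D (slope_arc e) = NodeT R.
Proof.
by move=> /first_edgeP /unbounded_left nb; rewrite /arc_head/= /node_of asboolF.
Qed.

Lemma tail_slope_next e e' : next_edge D e e' ->
  arc_tail D (slope_arc e) = FaceNode (face D e e').
Proof.
move=> ee'; rewrite /arc_tail/= /node_of -/(tl e) -/(hd e) (region_right_face ee').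
by rewrite asboolT//; exact: bounded_face.
Qed.

Lemma head_slope_next e e' : next_edge D e e' ->
  arc_head D (slope_arc e') = FaceNode (face D e e').
Proof.
move=> ee'; rewrite /arc_head/= /node_of -/(tl e') -/(hd e') (region_left_face ee').
by rewrite asboolT//; exact: bounded_face.
Qed.

Implicit Type g : space_pair G.

Lemma space_pairP g : [/\ level (val g).1 = level (val g).2,
  X (val g).1 < X (val g).2 &
  forall w, level w = level (val g).1 -> X w <= X (val g).1 \/ X (val g).2 <= X w].
Proof. exact: (consecutiveP hembed _ _ (valP g)). Qed.

Lemma tail_space_bottom g : level (val g).1 = 1%N -> arc_tail D (space_arc g) = NodeS R.
Proof.
by move=> /(unbounded_below (b := (val g).2)) nb; rewrite /arc_tail/= /node_of asboolF.
Qed.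

Lemma head_space_top g : level (val g).1 = k -> arc_head D (space_arc g) = NodeT R.
Proof.
by move=> /(unbounded_above (b := (val g).2)) nb; rewrite /arc_head/= /node_of asboolF.
Qed.

Lemma head_space_face g e e' : next_edge D e e' -> level (val g).1 = lv e ->
  X (tl e) <= X (val g).1 -> X (val g).2 <= X (tl e') ->
  arc_head D (space_arc g) = FaceNode (face D e e').
Proof.
have [_ ab _] := space_pairP g; move=> ee' la ea be'.
rewrite /arc_head/= /node_of (region_above_face ee')//.
by rewrite asboolT//; exact: bounded_face.
Qed.

Lemma tail_space_face g e e' : next_edge D e e' -> level (val g).1 = (lv e).+1 ->
  X (hd e) <= X (val g).1 -> X (val g).2 <= X (hd e') ->
  arc_tail D (space_arc g) = FaceNode (face D e e').
Proof.
have [_ ab _] := space_pairP g; move=> ee' la ea be'.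
rewrite /arc_tail/= /node_of (region_below_face ee')//.
by rewrite asboolT//; exact: bounded_face.
Qed.

(* [t] selects the end vertices lying on the level of [g]. *)
Lemma straddling_edges g (n : nat) (t : edge_pair G -> G) (e0 : edge_pair G) :
  (forall e, lv e = n -> level (t e) = level (val g).1) ->
  lv e0 = n -> X (t e0) <= X (val g).1 ->
  (forall e, lv e = n -> on_path pR e -> X (val g).2 <= X (t e)) ->
  exists e e', [/\ next_edge D e e', lv e = n, X (t e) <= X (val g).1 &
                   X (val g).2 <= X (t e')].
Proof.
have [_ ab gap] := space_pairP g; move=> lt le0 te0 lastP.
(* The rightmost edge that ends at or left of the segment is taken; its successor must end at or
   beyond the right end, as no vertex lies strictly inside the segment. *)
pose P e := (lv e == n) && (X (t e) <= X (val g).1).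
have P0 : P e0 by rewrite /P le0 eqxx.
have [e /andP[/eqP en te] max_e] :=
  @arg_maxP _ _ _ e0 P (fun e => trace D e (n%:R + 2^-1)) P0.
exists e; have [/(lastP _ en) be|[e' ee']] := next_or_last e.
  by have := lt_le_trans ab be; rewrite ltNge te.
exists e'; split=> //.
have e'n : lv e' = n by rewrite -(next_edge_lv ee').
have [te'|//] := gap _ (lt _ e'n).
have /= := max_e e'; rewrite /P e'n eqxx te' => /(_ erefl).
by have /andP[_] := next_edge_lt ee'; rewrite /mid en ltNge => /negP.
Qed.

Lemma head_space_exists g : (level (val g).1 < k)%N ->
  exists e e', [/\ next_edge D e e', lv e = level (val g).1,
    X (tl e) <= X (val g).1 & X (val g).2 <= X (tl e')].
Proof.
move=> lk; have [lab _ _] := space_pairP g.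
have /andP[l1 _] := level_range (val g).1.
have [|e0 [le0 te0 _]] := path_edge hL.1 (n := level (val g).1); first by rewrite l1.
apply: (@straddling_edges g (level (val g).1) (@tl _ _) e0) => //.
  by rewrite te0; case/andP: (boundary_le (val g).1).
by move=> e le /andP[/eqP -> _]; rewrite le lab; case/andP: (boundary_le (val g).2).
Qed.

Lemma tail_space_exists g : (1 < level (val g).1)%N ->
  exists e e', [/\ next_edge D e e', level (val g).1 = (lv e).+1,
    X (hd e) <= X (val g).1 & X (val g).2 <= X (hd e')].
Proof.
move=> lk; have [lab _ _] := space_pairP g.
have /andP[l1 lk'] := level_range (val g).1.
have [|e0 [le0 _ he0]] := path_edge hL.1 (n := (level (val g).1).-1).
  by rewrite prednK// -ltnS prednK// lk.
have [||||e [e' [ee' en ha hb]]] := @straddling_edges g (level (val g).1).-1 (@hd _ _) e0.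
- by move=> e le; rewrite level_hd le prednK.
- exact: le0.
- by rewrite he0 prednK//; case/andP: (boundary_le (val g).1).
- move=> e le /andP[_ /eqP ->]; rewrite le prednK// lab.
  by case/andP: (boundary_le (val g).2).
- by exists e, e'; split=> //; rewrite en prednK.
Qed.

End Sides.

(** * Conservation of flow *)

Section Flow.
Context (R : realType) (k : nat) (G : embedded_proper_level_graph k).
Context (D : drawing R G).
Hypotheses (hplanar : level_planar D) (hembed : induces_embedding D).
Context (pL pR : nat -> G) (hL : left_boundary pL) (hR : right_boundary pR).

Let X := xcoord D.

Implicit Types (x : {ffun G -> int}) (phi : {ffun flow_arc G -> int}).
Implicit Types (u v w : G) (g : space_pair G) (e f : edge_pair G).

(** * Telescoping sums over space arcs and boundary paths *)

Lemma pred_exists u v : level u = level v -> X u < X v ->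
  exists g, [/\ (val g).2 = v, level (val g).1 = level u & X u <= X (val g).1].
Proof.
move=> luv uv; pose P w := (level w == level u) && (X w < X v).
have Pu : P u by rewrite /P eqxx.
have [p /andP[/eqP lp pv] max_p] := @arg_maxP _ _ _ u P X Pu.
have cpv : consecutive p v.
  apply/(consecutiveP hembed); split=> //; first by rewrite lp.
  move=> w lw; have [|wv] := leP (X v) (X w); first by right.
  by left; apply: max_p; rewrite /P lw lp eqxx.
exists (exist (fun e : G * G => consecutive e.1 e.2) (p, v) cpv).
by split=> //=; apply: max_p.
Qed.

Lemma succ_exists u v : level u = level v -> X u < X v -> exists w, consecutive u w.
Proof.
move=> luv uv; pose P w := (level w == level u) && (X u < X w).
have Pv : P v by rewrite /P luv eqxx.
have [p /andP[/eqP lp up] min_p] := @arg_minP _ _ _ v P X Pv.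
exists p; apply/(consecutiveP hembed); split=> //.
move=> w lw; have [|uw] := leP (X w) (X u); first by left.
by right; apply: min_p; rewrite /P lw eqxx.
Qed.

Definition between u v g : bool :=
  [&& level (val g).1 == level u, X u <= X (val g).1 & X (val g).2 <= X v].

(** The gap that ends at [v] is peeled off; the remaining gaps are those up to its left vertex,
    which has fewer vertices to its left. *)
Lemma sum_between x u v : level u = level v -> X u <= X v ->
  \sum_(g | between u v g) (x (val g).2 - x (val g).1) = x v - x u.
Proof.
have [n] := ubnP #|[pred w | (level w == level u) && (X w < X v)]|.
elim: n v => // n IH v le_n luv; rewrite le_eqVlt => /orP[/eqP Xuv|uv].
  rewrite (xcoord_inj hplanar luv Xuv) subrr big_pred0// => g.
  apply/negP => /and3P[_ vg gv]; have [_ + _] := space_pairP hembed g.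
  by rewrite ltNge (le_trans gv vg).
have [g0 [g0v lg0 ug0]] := pred_exists luv uv.
have [_ lt0 gap0] := space_pairP hembed g0; rewrite g0v in lt0 gap0.
rewrite (bigD1 g0) /=; last by rewrite /between lg0 eqxx ug0 g0v /=.
rewrite g0v (eq_bigl (between u (val g0).1)) => [|g]; last first.
  apply/idP/idP=> [/andP[/and3P[/eqP lg ug gv] gg0]|/and3P[/eqP lg ug gv]].
    rewrite /between lg eqxx ug/=.
    have [lg2 ltg gapg] := space_pairP hembed g.
    (* If [g] ended right of the left vertex of [g0], it would end at [v], would then also start
       with [g0], and so be [g0]. *)
    have [//|vg2] := gap0 (val g).2 (etrans (esym lg2) (etrans lg (esym lg0))).
    case/negP: gg0; apply/eqP/val_inj.
    have g2v : (val g).2 = v.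
      apply: (xcoord_inj hplanar); first by rewrite -lg2 lg.
      by apply/eqP; rewrite eq_le gv vg2.
    have g1 : (val g).1 = (val g0).1.
      apply: (xcoord_inj hplanar); first by rewrite lg lg0.
      apply/eqP; rewrite eq_le; apply/andP; split.
        have [//|] := gap0 (val g).1 (etrans lg (esym lg0)).
        by rewrite leNgt -g2v ltg.
      have [//|] := gapg (val g0).1 (etrans lg0 (esym lg)).
      by rewrite g2v leNgt lt0.
    by rewrite [LHS]surjective_pairing [RHS]surjective_pairing g1 g2v g0v.
  rewrite /between lg eqxx ug (le_trans gv (ltW lt0))/=.
  apply/eqP => gg0; move: gv; rewrite gg0 g0v leNgt.
  by rewrite lt0.
rewrite IH ?lg0//; first by ring.
rewrite ltnS in le_n; apply: leq_trans le_n; apply: proper_card; apply/properP; split.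
  apply/fintype.subsetP => w; rewrite !inE => /andP[-> /lt_trans]; exact.
by exists (val g0).1; rewrite !inE ?lg0 ?eqxx ?lt0 ?ltxx.
Qed.

Lemma sum_path x (p : nat -> G) (n : nat) : level_path p -> (1 <= n <= k)%N ->
  \sum_(e | on_path p e && (lv e < n)%N) (x (hd e) - x (tl e)) = x (p n) - x (p 1%N).
Proof.
move=> lp; elim: n => // n IH /andP[_ nk].
have [->|n0] := posnP n.
  rewrite subrr big_pred0// => e; have /andP[l0 _] := lv_range e.
  by apply/negP => /andP[_]; rewrite ltnS leqNgt l0.
have [|e [le te he]] := path_edge lp (n := n); first by rewrite n0.
rewrite (bigD1 e) /=; last by rewrite /on_path le te he !eqxx ltnS leqnn.
rewrite te he (eq_bigl (fun e => on_path p e && (lv e < n)%N)) => [|f].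
  by rewrite IH ?n0 ?(ltnW nk)//; ring.
rewrite ltnS -andbA; case: (boolP (on_path p f)) => //= /andP[/eqP tf /eqP hf].
rewrite ltn_neqAle andbC; congr andb; apply/negb_inj; rewrite !negbK.
apply/eqP/eqP => [->//|lf]; apply: edge_pair_inj.
  by rewrite tf te lf.
by rewrite hf he lf.
Qed.

Lemma sum_full_path x (p : nat -> G) : (1 <= k)%N -> level_path p ->
  \sum_(e | on_path p e) (x (hd e) - x (tl e)) = x (p k) - x (p 1%N).
Proof.
move=> k1 lp; rewrite -sum_path ?k1 ?leqnn//; apply: eq_bigl => e.
by have /andP[_ ->] := lv_range e; rewrite andbT.
Qed.

(** Together with [tail_face_inv] this reduces conservation to the cells: at any other face node
    both sums are empty. *)
Lemma head_face_inv a C : arc_head D a = FaceNode C ->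
  exists e e', next_edge D e e' /\ C = face D e e'.
Proof.
case: a => [[e|g]|[]] //.
  have [/(head_slope_first hplanar hembed hL hR) h|[f fe]] :=
    prev_or_first hplanar hembed hL hR e.
    by rewrite -/(slope_arc e) h.
  by rewrite -/(slope_arc e) (head_slope_next hplanar hembed fe) => -[<-]; exists f, e.
have /andP[_] := level_range (val g).1; rewrite leq_eqVlt => /orP[/eqP lk|lk].
  by rewrite -/(space_arc g) head_space_top.
have [e [e' [ee' le h h']]] := head_space_exists hplanar hembed hL hR lk.
by rewrite -/(space_arc g) (head_space_face hplanar hembed ee')// => -[<-]; exists e, e'.
Qed.

Lemma tail_face_inv a C : arc_tail D a = FaceNode C ->
  exists e e', next_edge D e e' /\ C = face D e e'.
Proof.
case: a => [[e|g]|[]] //.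
  have [/(tail_slope_last hplanar hembed hL hR) h|[f fe]] :=
    next_or_last hplanar hembed hL hR e.
    by rewrite -/(slope_arc e) h.
  by rewrite -/(slope_arc e) (tail_slope_next hplanar hembed fe) => -[<-]; exists e, f.
have /andP[] := level_range (val g).1; rewrite leq_eqVlt => /orP[/eqP lk|lk] _.
  by rewrite -/(space_arc g) tail_space_bottom.
have [e [e' [ee' le h h']]] := tail_space_exists hplanar hembed hL hR lk.
by rewrite -/(space_arc g) (tail_space_face hplanar hembed ee')// => -[<-]; exists e, e'.
Qed.

(** For [x = coord_of_flow pR phi] this holds by construction, for any [phi]; agreement on the slope
    arcs off [pR] is what conservation has to supply. *)
Definition spacing phi x := forall g, phi (space_arc g) = x (val g).2 - x (val g).1.

Lemma sum_flow_arc (P : flow_arc G -> bool) phi :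
  \sum_(a | P a) phi a = \sum_(e | P (slope_arc e)) phi (slope_arc e) +
    \sum_(g | P (space_arc g)) phi (space_arc g) +
    (if P (ts_arc G) then phi (ts_arc G) else 0).
Proof.
rewrite big_sumType/= big_sumType/=; congr (_ + _).
by case: ifP => Pt; [rewrite (big_pred1 tt)// => -[]|rewrite big_pred0// => -[]].
Qed.

(** Slope arcs cross edges from right to left, so only the right edge [e'] feeds the face;
    [face_inj] rules out the arcs that enter other cells. *)
Lemma inflow_face phi x e e' : spacing phi x -> next_edge D e e' ->
  \sum_(a | `[< arc_head D a = FaceNode (face D e e') >]) phi a =
  phi (slope_arc e') + (x (tl e') - x (tl e)).
Proof.
move=> sp ee'; rewrite sum_flow_arc asboolF// addr0; congr (_ + _).
  apply: big_pred1 => f; apply/asboolP/eqP => [|->]; last exact: head_slope_next.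
  have [/(head_slope_first hplanar hembed hL hR) ->//|[f' ff']] :=
    prev_or_first hplanar hembed hL hR f.
  rewrite (head_slope_next hplanar hembed ff') => -[].
  by move=> /(face_inj hplanar ff' ee') [].
rewrite -sum_between; [|exact: next_edge_lv ee'|]; last first.
  by apply: edge_lt_tl => //; exact: next_edge_lt.
under eq_bigr do rewrite sp; apply: eq_bigl => g.
apply/asboolP/and3P => [|[/eqP lg eg ge']]; last exact: head_space_face.
have /andP[_] := level_range (val g).1; rewrite leq_eqVlt => /orP[/eqP lk|lk].
  by rewrite head_space_top.
have [f [f' [ff' lf h h']]] := head_space_exists hplanar hembed hL hR lk.
rewrite (head_space_face hplanar hembed ff')// => -[].
by move=> /(face_inj hplanar ff' ee') [<- <-]; rewrite -[level (tl f)]/(lv f) lf.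
Qed.

Lemma outflow_face phi x e e' : spacing phi x -> next_edge D e e' ->
  \sum_(a | `[< arc_tail D a = FaceNode (face D e e') >]) phi a =
  phi (slope_arc e) + (x (hd e') - x (hd e)).
Proof.
move=> sp ee'; rewrite sum_flow_arc asboolF// addr0; congr (_ + _).
  apply: big_pred1 => f; apply/asboolP/eqP => [|->]; last exact: tail_slope_next.
  have [/(tail_slope_last hplanar hembed hL hR) ->//|[f' ff']] :=
    next_or_last hplanar hembed hL hR f.
  rewrite (tail_slope_next hplanar hembed ff') => -[].
  by move=> /(face_inj hplanar ff' ee') [].
rewrite -sum_between; [|by rewrite !level_hd (next_edge_lv ee')|]; last first.
  by apply: edge_lt_hd => //; exact: next_edge_lt.
under eq_bigr do rewrite sp; apply: eq_bigl => g.
apply/asboolP/and3P => [|[/eqP lg eg ge']]; last first.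
  by apply: tail_space_face => //; rewrite lg level_hd.
have /andP[] := level_range (val g).1; rewrite leq_eqVlt => /orP[/eqP lk|lk] _.
  by rewrite tail_space_bottom.
have [f [f' [ff' lf h h']]] := tail_space_exists hplanar hembed hL hR lk.
rewrite (tail_space_face hplanar hembed ff')// => -[].
by move=> /(face_inj hplanar ff' ee') [<- <-]; rewrite level_hd lf.
Qed.

(** The outer node of every head is [NodeT], so only the arc [ts_arc] can enter [s]. *)
Lemma inflow_S phi : \sum_(a | `[< arc_head D a = NodeS R >]) phi a = phi (ts_arc G).
Proof.
rewrite sum_flow_arc asboolT// !big_pred0 ?add0r// => a; apply: asboolF.
  by rewrite /arc_head /= /node_of; case: ifP.
by rewrite /arc_head /= /node_of; case: ifP.
Qed.

Lemma outflow_T phi : \sum_(a | `[< arc_tail D a = NodeT R >]) phi a = phi (ts_arc G).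
Proof.
rewrite sum_flow_arc asboolT// !big_pred0 ?add0r// => a; apply: asboolF.
  by rewrite /arc_tail /= /node_of; case: ifP.
by rewrite /arc_tail /= /node_of; case: ifP.
Qed.

Lemma sum_level phi x (n : nat) : spacing phi x -> (1 <= n <= k)%N ->
  \sum_(g | level (val g).1 == n) phi (space_arc g) = x (pR n) - x (pL n).
Proof.
move=> sp nk; have [lL _] := hL.1; have [lR _] := hR.1.
have ln : level (pL n) = level (pR n) by rewrite lL ?lR.
rewrite -sum_between//; last first.
  by case/andP: (boundary_le hembed hL hR (pL n)); rewrite lL.
under eq_bigr do rewrite sp; apply: eq_bigl => g; rewrite /between lL//.
case: eqP => //= lg; have [lg2 _ _] := space_pairP hembed g.
have /andP[h _] := boundary_le hembed hL hR (val g).1.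
have /andP[_ h'] := boundary_le hembed hL hR (val g).2.
by rewrite -lg h lg2 h'.
Qed.

Hypothesis hk : (1 <= k)%N.

(** The arcs leaving [s] cross level 1 from [pL 1] to [pR 1] and then climb [pR], so their flow
    telescopes to the difference that [flow_of_coord] assigns to [ts_arc]. At [t] the detour along
    [pL] and level [k] has the same end points. *)
Lemma outflow_S phi x : spacing phi x ->
  (forall e, on_path pR e -> phi (slope_arc e) = x (hd e) - x (tl e)) ->
  \sum_(a | `[< arc_tail D a = NodeS R >]) phi a = x (pR k) - x (pL 1%N).
Proof.
move=> sp sl; rewrite sum_flow_arc asboolF// addr0.
rewrite (eq_bigl (on_path pR)) => [|e]; last first.
  apply/asboolP/idP => [|]; last exact: (tail_slope_last hplanar hembed hL hR).
  have [//|[f ef]] := next_or_last hplanar hembed hL hR e.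
  by rewrite (tail_slope_next hplanar hembed ef).
rewrite (eq_bigr _ sl) sum_full_path//; last exact: hR.1.
rewrite (eq_bigl (fun g => level (val g).1 == 1%N)) => [|g].
  by rewrite (sum_level sp) ?hk//; ring.
apply/asboolP/eqP => [|]; last exact: tail_space_bottom.
have /andP[] := level_range (val g).1; rewrite leq_eqVlt => /orP[/eqP//|lk] _.
have [f [f' [ff' lf h h']]] := tail_space_exists hplanar hembed hL hR lk.
by rewrite (tail_space_face hplanar hembed ff').
Qed.

Lemma inflow_T phi x : spacing phi x ->
  (forall e, on_path pL e -> phi (slope_arc e) = x (hd e) - x (tl e)) ->
  \sum_(a | `[< arc_head D a = NodeT R >]) phi a = x (pR k) - x (pL 1%N).
Proof.
move=> sp sl; rewrite sum_flow_arc asboolF// addr0.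
rewrite (eq_bigl (on_path pL)) => [|e]; last first.
  apply/asboolP/idP => [|]; last exact: (head_slope_first hplanar hembed hL hR).
  have [//|[f ef]] := prev_or_first hplanar hembed hL hR e.
  by rewrite (head_slope_next hplanar hembed ef).
rewrite (eq_bigr _ sl) sum_full_path//; last exact: hL.1.
rewrite (eq_bigl (fun g => level (val g).1 == k)) => [|g].
  by rewrite (sum_level sp) ?hk ?leqnn//; ring.
apply/asboolP/eqP => [|]; last exact: head_space_top.
have /andP[_] := level_range (val g).1; rewrite leq_eqVlt => /orP[/eqP//|lk].
have [f [f' [ff' lf h h']]] := head_space_exists hplanar hembed hL hR lk.
by rewrite (head_space_face hplanar hembed ff').
Qed.

Lemma flow_of_coord_slope x e :
  flow_of_coord pL pR x (slope_arc e) = x (hd e) - x (tl e).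
Proof. by rewrite ffunE. Qed.

Lemma flow_of_coord_spacing x : spacing (flow_of_coord pL pR x) x.
Proof. by move=> g; rewrite ffunE. Qed.

Lemma flow_of_coord_conservation x n :
  \sum_(a | `[< arc_head D a = n >]) flow_of_coord pL pR x a =
  \sum_(a | `[< arc_tail D a = n >]) flow_of_coord pL pR x a.
Proof.
have sp := flow_of_coord_spacing x.
have sl (p : nat -> G) e : on_path p e -> _ := fun=> flow_of_coord_slope x e.
case: n => [C||].
- have [[e [e' [ee' ->]]]|nC] :=
    pselect (exists e e', next_edge D e e' /\ C = face D e e').
    rewrite (inflow_face sp ee') (outflow_face sp ee') !flow_of_coord_slope.
    by ring.
  rewrite !big_pred0// => a; apply: asboolF.
    by move=> /tail_face_inv.
  by move=> /head_face_inv.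
- by rewrite inflow_S (outflow_S sp (sl pR)) ffunE.
- by rewrite outflow_T (inflow_T sp (sl pL)) ffunE.
Qed.

Lemma conservation_slopes phi x : spacing phi x ->
  (forall e, on_path pR e -> phi (slope_arc e) = x (hd e) - x (tl e)) ->
  (forall n, face_nodes D n ->
    \sum_(a | `[< arc_head D a = n >]) phi a =
    \sum_(a | `[< arc_tail D a = n >]) phi a) ->
  phi = flow_of_coord pL pR x.
Proof.
move=> sp sl cons; apply/ffunP => -[[e|g]|[]].
- rewrite -/(slope_arc e) flow_of_coord_slope.
  have [n] := ubnP #|[pred f | edge_lt D e f]|; elim: n e => // n IH e le_n.
  have [/sl//|[e' ee']] := next_or_last hplanar hembed hL hR e.
  have /cons : face_nodes D (FaceNode (face D e e')).
    by split; [exact: is_face_face|exact: bounded_face].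
  rewrite (inflow_face sp ee') (outflow_face sp ee') IH => [?|]; first lia.
  have lt_ee' := next_edge_lt ee'.
  rewrite ltnS in le_n; apply: leq_trans le_n; apply: proper_card; apply/properP; split.
    by apply/fintype.subsetP => f; rewrite !inE; exact: edge_lt_trans.
  by exists e'; rewrite !inE ?edge_lt_irr.
- by rewrite -/(space_arc g) sp flow_of_coord_spacing.
- have /cons : face_nodes D (NodeS R) by [].
  by rewrite inflow_S (outflow_S sp sl) -/(ts_arc G) => ->; rewrite ffunE.
Qed.

End Flow.

(** * Coordinates *)

Section Coordinates.
Context (R : realType) (k : nat) (G : embedded_proper_level_graph k).
Context (D : drawing R G).
Hypotheses (hplanar : level_planar D) (hembed : induces_embedding D).
Let X := xcoord D.

Implicit Types (x : {ffun G -> int}) (phi : {ffun flow_arc G -> int}).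
Implicit Types (u v w : G) (g : space_pair G) (e f : edge_pair G).

(** A walk from [u] to [v] can be shortened to one without repeated vertices, hence with fewer than
    [#|G|] steps. Each step raises [x] by at most $\lambda-1$, also when its edge is traversed
    downwards. *)
Lemma connected_gap (lambda : nat) x : graph_connected G ->
  (forall u w, edge u w -> 0 <= slope x u w <= lambda%:Z - 1) ->
  forall u v, consecutive u v -> x v - x u <= space_capacity G lambda.
Proof.
move=> conn sl u v uv.
have ne : u <> v.
  by move=> eq_; move: uv => /(consecutiveP hembed)[_]; rewrite eq_ ltxx.
have /connectP[p0 p0P vp0] := conn u v.
have [p [pP up vp]] : exists p, [/\ path (fun a b : G => edge a b || edge b a) u p,
    uniq (u :: p) & v = last u p].
  by move: vp0; case/shortenP: p0P => p pP up _ ->; exists p.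
have step a b : edge a b || edge b a -> x b - x a <= lambda%:Z - 1 /\ 0 <= lambda%:Z - 1.
  by rewrite /slope in sl; case/orP => /sl /andP[]; lia.
have len : x v - x u <= (lambda%:Z - 1) * (size p)%:Z.
  rewrite vp; elim: p u pP {up vp uv ne p0P vp0} => [|b p IH] a /=.
    by rewrite subrr mulr0.
  by case/andP => /step[h _] /IH; rewrite intS mulrDr mulr1; lia.
(* Since [u] and [v] differ, the path contains an edge, whose range of slopes is therefore nonempty.
   The sign is needed to pass from the length of the path to $n-1$. *)
have lam : 0 <= lambda%:Z - 1.
  by case: p pP vp {up len} => [|b p] /= => [_ /esym//|/andP[/step[]]].
apply: (le_trans len); rewrite /space_capacity; apply: ler_wpM2l => //.
have size_lt : (size p < #|G|)%N.
  have <- : #|u :: p| = (size p).+1 := card_uniqP up.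
  exact: max_card.
by rewrite lerBrDr addrC -intS lez_nat.
Qed.

(** * Recursion equations of the coordinates of a flow *)

Definition right_count w : nat := #|[pred v | left_of w v]|.

Lemma consecutive_inj w v v' : consecutive w v -> consecutive w v' -> v = v'.
Proof.
move=> /(consecutiveP hembed)[lv wv gv] /(consecutiveP hembed)[lv' wv' gv'].
apply: (xcoord_inj hplanar); first by rewrite -lv.
apply/eqP; rewrite eq_le; apply/andP; split.
  by have [|//] := gv v' (esym lv'); rewrite leNgt wv'.
by have [|//] := gv' v (esym lv); rewrite leNgt wv.
Qed.

Lemma right_count_lt w v : consecutive w v -> (right_count v < right_count w)%N.
Proof.
move=> /(consecutiveP hembed)[lv wv _]; apply: proper_card; apply/properP; split.
  apply/fintype.subsetP => u; rewrite !inE !(left_ofE hembed) -lv.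
  by move=> /andP[-> /(lt_trans wv)].
by exists v; rewrite !inE !(left_ofE hembed) ?lv eqxx /= ?wv ?ltxx.
Qed.

Lemma right_count_max w : (right_count w < #|G|)%N.
Proof.
apply: proper_card; apply/properP; split.
  exact/fintype.subsetP.
by exists w; rewrite !inE// (left_ofE hembed) ltxx andbF.
Qed.

Context (pL pR : nat -> G) (hL : left_boundary pL) (hR : right_boundary pR).
Hypothesis hk : (1 <= k)%N.

(** Each recursive step moves to the right neighbour and lowers [right_count], so any fuel above
    this count reaches the right end of the level and gives the same value. *)
Lemma coord_rec_stable phi m m' w : (right_count w < m)%N -> (right_count w < m')%N ->
  coord_rec pR m phi w = coord_rec pR m' phi w.
Proof.
elim: m m' w => // m IH [//|m'] w wm wm' /=; case: pickP => // v /right_count_lt vw.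
by congr (_ - _); apply: IH; exact: leq_trans vw _.
Qed.

Lemma coord_of_flow_step phi w v : consecutive w v ->
  coord_of_flow pR phi w = coord_of_flow pR phi v - space_flow phi w v.
Proof.
move=> wv; rewrite !ffunE (@coord_rec_stable phi #|G| #|G|.+1 w) ?right_count_max//=.
  case: pickP => [v' /(consecutive_inj wv) <-//|/(_ v)].
  by rewrite wv.
by rewrite ltnS ltnW// right_count_max.
Qed.

Lemma right_boundary_last n v : (1 <= n <= k)%N -> ~~ consecutive (pR n) v.
Proof.
move=> nk; apply/negP => /andP[lt_nv _]; have [lR _] := hR.1; have := hR.2 v.
move: (lt_nv); rewrite (left_ofE hembed) => /andP[/eqP <- _].
by rewrite lR// lt_nv.
Qed.

Lemma coord_of_flow_boundary phi n : (1 <= n <= k)%N ->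
  coord_of_flow pR phi (pR n) = boundary_coord pR phi n.-1.
Proof.
move=> nk; have [lR _] := hR.1.
rewrite ffunE (@coord_rec_stable phi #|G| #|G|.+1) ?right_count_max//=.
  case: pickP => [v cv|_]; last by rewrite lR.
  by have := right_boundary_last v nk; rewrite cv.
by rewrite ltnS ltnW// right_count_max.
Qed.

Lemma space_flowE phi g : space_flow phi (val g).1 (val g).2 = phi (space_arc g).
Proof. by rewrite /space_flow -surjective_pairing valK. Qed.

Lemma slope_flowE phi e : slope_flow phi (tl e) (hd e) = phi (slope_arc e).
Proof. by rewrite /slope_flow -surjective_pairing valK. Qed.

Lemma coord_of_flow_spacing phi : spacing phi (coord_of_flow pR phi).
Proof.
by move=> g; rewrite (coord_of_flow_step phi (valP g)) space_flowE; ring.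
Qed.

Lemma coord_of_flow_slope phi e : on_path pR e ->
  phi (slope_arc e) = coord_of_flow pR phi (hd e) - coord_of_flow pR phi (tl e).
Proof.
move=> /andP[/eqP te /eqP he]; have /andP[l1 lk] := lv_range e.
rewrite -slope_flowE te he !coord_of_flow_boundary ?l1 ?(ltnW lk)//=.
by case: (lv e) l1 => // n _ /=; ring.
Qed.

Lemma coord_of_flow_start phi : coord_of_flow pR phi (pR 1%N) = 0.
Proof. by rewrite coord_of_flow_boundary ?hk. Qed.

(** Both functions obey the same recursion, up along [pR] and then leftwards on each level; the
    normalisation gives them the same start value. *)
Lemma flow_of_coordK x : x (pR 1%N) = 0 -> coord_of_flow pR (flow_of_coord pL pR x) = x.
Proof.
move=> x0; pose phi := flow_of_coord pL pR x.
have xb n : (1 <= n <= k)%N -> coord_of_flow pR phi (pR n) = x (pR n).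
  move=> nk; rewrite coord_of_flow_boundary//.
  case: n nk => // n; elim: n => // n IH nk /=.
  have nk' : (1 <= n.+1 < k)%N by [].
  have [e [_ te he]] := path_edge hR.1 nk'.
  have -> : slope_flow phi (pR n.+1) (pR n.+2) = x (pR n.+2) - x (pR n.+1).
    by rewrite -te -he slope_flowE flow_of_coord_slope.
  by rewrite [boundary_coord _ _ _]IH ?(ltnW nk)//; ring.
apply/ffunP => w; have [n] := ubnP (right_count w); elim: n w => // n IH w le_n.
have [wR|/eqP wR] := eqVneq w (pR (level w)).
  by rewrite wR; apply: xb; exact: level_range.
have lw : level w = level (pR (level w)) by have [-> //] := hR.1; exact: level_range.
have [|v wv] := succ_exists hembed lw (v := pR (level w)).
  have /andP[_] := boundary_le hembed hL hR w.
  rewrite le_eqVlt => /orP[/eqP eqX|//].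
  by case: wR; exact: (xcoord_inj hplanar lw).
pose g : space_pair G := exist _ (w, v) wv.
rewrite (coord_of_flow_step _ wv) (space_flowE _ g) flow_of_coord_spacing /= IH; first by ring.
exact: leq_trans (right_count_lt wv) _.
Qed.

(** * Drawings yield circulations and conversely *)

Lemma lambda_drawing_lt (lambda : nat) x u v : lambda_drawing R lambda x ->
  level u = level v -> X u < X v -> x u < x v.
Proof.
move=> [_ emb _] luv uv; have := emb u v.
by rewrite (left_ofE hembed) luv eqxx/= uv ltr_int => <-.
Qed.

Lemma lambda_drawing_le (lambda : nat) x u v : lambda_drawing R lambda x ->
  level u = level v -> X u <= X v -> x u <= x v.
Proof.
move=> dx luv; rewrite le_eqVlt => /orP[/eqP /(xcoord_inj hplanar luv) -> //|uv].
exact/ltW/(lambda_drawing_lt dx).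
Qed.

Lemma lambda_drawing_circulation (lambda : nat) x : lambda_drawing R lambda x ->
  (forall u v, consecutive u v -> x v - x u <= space_capacity G lambda) ->
  circulation (F := lambda_network D lambda) (flow_of_coord pL pR x).
Proof.
move=> dx cap; have [_ _ sl] := dx.
have ge_demand (a : flow_arc G) : arc_demand a <= flow_of_coord pL pR x a.
  case: a => [[e|g]|[]] /=; rewrite ffunE /= -/(tl _) -/(hd _).
  - by have /andP[] := sl _ _ (edge_tl_hd e).
  - have [luv uv _] := space_pairP hembed g.
    by have := lambda_drawing_lt dx luv uv; rewrite -subr_gt0 gtz0_ge1.
  (* On [ts_arc] the value is the climb along [pR] plus the width of level 1, and neither is
     negative. *)
  - have [lR _] := hR.1; have [lL _] := hL.1.
    have : 0 <= x (pR k) - x (pR 1%N).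
      rewrite -sum_full_path//; last exact: hR.1.
      by apply: sumr_ge0 => e _; have /andP[] := sl _ _ (edge_tl_hd e).
    have : x (pL 1%N) <= x (pR 1%N).
      have l1 : (1 <= 1 <= k)%N by rewrite hk.
      apply: (lambda_drawing_le dx); first by rewrite lL ?lR.
      by have /andP[_] := boundary_le hembed hL hR (pL 1%N); rewrite lL.
    by lia.
split.
- move=> a; apply: le_trans (ge_demand a); by case: a => [[]|[]].
- exact: ge_demand.
- move=> [[e|g]|[]] c //= [<-]; rewrite ffunE /=.
  + by have /andP[_] := sl _ _ (edge_tl_hd e).
  + by apply: cap; exact: (valP g).
- by move=> n _; exact: flow_of_coord_conservation.
Qed.

(** Planarity of [D] orders both ends of two edges of a strip in the same way, and monotonicity
    carries this to [x]. Segments with ends ordered in this way meet only at a common end. *)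
Lemma level_planar_straight_line x :
  (forall u v, level u = level v -> X u < X v -> x u < x v) ->
  level_planar (straight_line R x).
Proof.
move=> mono.
have mono_le u v : level u = level v -> X u <= X v -> x u <= x v.
  move=> luv; rewrite le_eqVlt => /orP[/eqP /(xcoord_inj hplanar luv) -> //|].
  by move=> /(mono _ _ luv) /ltW.
have inj u v : level u = level v -> x u = x v -> u = v.
  move=> luv xuv; have [/(mono _ _ luv)|/(mono _ _ (esym luv))|] := ltgtP (X u) (X v).
  - by rewrite xuv ltxx.
  - by rewrite xuv ltxx.
  - exact: xcoord_inj.
pose line e (y : R) : R := (x (tl e))%:~R + (y - (lv e)%:R) * (slope x (tl e) (hd e))%:~R.
have lineE e y : line e y = (1 - (y - (lv e)%:R)) * (x (tl e))%:~R +
    (y - (lv e)%:R) * (x (hd e))%:~R.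
  by rewrite /line /slope intrB; ring.
have meet e f y : edge_lt D e f -> (lv e)%:R <= y <= (lv e).+1%:R ->
    line e y = line f y -> (y = (lv e)%:R /\ tl e = tl f) \/
      (y = (lv e).+1%:R /\ hd e = hd f).
  move=> ef; rewrite -[(lv e).+1%:R]natr1 => /andP[y0 y1].
  rewrite !lineE -(edge_lt_lv ef) => eq_line.
  have ltl : level (tl e) = level (tl f) by exact: (edge_lt_lv ef).
  have lhd : level (hd e) = level (hd f) by rewrite !level_hd (edge_lt_lv ef).
  have tt : (x (tl e))%:~R <= (x (tl f))%:~R :> R.
    by rewrite ler_int; exact: mono_le ltl (edge_lt_tl hplanar ef).
  have hh : (x (hd e))%:~R <= (x (hd f))%:~R :> R.
    by rewrite ler_int; exact: mono_le lhd (edge_lt_hd hplanar ef).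
  set s := y - (lv e)%:R in eq_line.
  have s0 : 0 <= s by rewrite subr_ge0.
  have s1 : 0 <= 1 - s by rewrite /s; lra.
  (* The two lines differ by the sum of this term and the one in [hs]; both are nonnegative, so
     where the lines meet both vanish. *)
  have ht : (1 - s) * ((x (tl f))%:~R - (x (tl e))%:~R) = 0 :> R.
    have : 0 <= (1 - s) * ((x (tl f))%:~R - (x (tl e))%:~R) :> R.
      by apply: mulr_ge0; rewrite // subr_ge0.
    have : 0 <= s * ((x (hd f))%:~R - (x (hd e))%:~R) :> R.
      by rewrite mulr_ge0 ?subr_ge0.
    by move: eq_line; rewrite !mulrBr; lra.
  have hs : s * ((x (hd f))%:~R - (x (hd e))%:~R) = 0 :> R.
    by move: eq_line ht; rewrite !mulrBr; lra.
  have tlE : x (tl f) = x (tl e) -> tl e = tl f by move=> ?; apply: inj.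
  have hdE : x (hd f) = x (hd e) -> hd e = hd f by move=> ?; apply: inj.
  (* If [s] is not 0, the heads coincide. Then [s = 1], or the tails coincide as well and [e] and
     [f] are the same edge, against [edge_lt e f]. *)
  have /orP[/eqP sz|] : (s == 0) || ((x (hd f))%:~R - (x (hd e))%:~R == 0 :> R).
  - by rewrite -mulf_eq0 hs.
  - left; split; first by move: sz; rewrite /s; lra.
    apply: tlE; move: ht; rewrite sz subr0 mul1r => /eqP; rewrite subr_eq0 eqr_int.
    by move/eqP.
  - rewrite subr_eq0 eqr_int => /eqP /hdE hh'.
    have /orP[/eqP s1z|] : (1 - s == 0) || ((x (tl f))%:~R - (x (tl e))%:~R == 0 :> R).
    + by rewrite -mulf_eq0 ht.
    + by right; split=> //; move: s1z; rewrite /s; lra.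
    + rewrite subr_eq0 eqr_int => /eqP /tlE tt'.
      by move: ef; rewrite (edge_pair_inj tt' hh') edge_lt_irr.
split.
- move=> u w uw; split=> //=.
  + apply: continuous_subspaceT => y; apply: cvgD; first exact: cvg_cst.
    by apply: cvgM; [apply: cvgB; [exact: cvg_id|exact: cvg_cst]|exact: cvg_cst].
  + by rewrite subrr mul0r addr0.
  + rewrite /height (edge_proper uw) -natr1 /slope intrB; ring.
- by move=> u v luv /= /eqP; rewrite eqr_int => /eqP; exact: inj.
- move=> u w u' w' y uw uw' ne yi yi' /= eq_line.
  pose e : edge_pair G := exist (fun p : G * G => edge p.1 p.2) (u, w) uw.
  pose f : edge_pair G := exist (fun p : G * G => edge p.1 p.2) (u', w') uw'.
  rewrite /height (edge_proper uw) -/(lv e) in yi.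
  rewrite /height (edge_proper uw') -/(lv f) in yi'.
  have shared v : v \in [:: u; w] -> v \in [:: u'; w'] -> y = (level v)%:R ->
      exists v, [/\ v \in [:: u; w], v \in [:: u'; w'] & y = height R v].
    by move=> *; exists v.
  (* Edges of different strips share a height only on a common level, so the strips are adjacent and
     the meeting point is the head of one edge and the tail of the other. *)
  have [lef|lfe|lef] := ltngtP (lv e) (lv f).
  + have yE : y = (lv f)%:R.
      apply/eqP; rewrite eq_le; case/andP: yi' => -> _; rewrite andbT.
      by case/andP: yi => _ /le_trans -> //; rewrite ler_nat.
    have lEf : lv f = (lv e).+1.
      apply/eqP; rewrite eqn_leq lef andbT; case/andP: yi => _.
      by rewrite yE ler_nat.
    apply: (shared w); rewrite ?inE ?eqxx ?orbT//; last first.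
      by rewrite yE lEf (edge_proper uw).
    apply/orP; left; apply/eqP; apply: inj; first by rewrite (edge_proper uw) -/(lv e) -lEf.
    have : line e y = line f y by [].
    rewrite !lineE yE lEf -natr1 => H; apply/eqP; rewrite -(eqr_int R); apply/eqP.
    by move: H; rewrite /tl /hd /=; lra.
  + have yE : y = (lv e)%:R.
      apply/eqP; rewrite eq_le; case/andP: yi => -> _; rewrite andbT.
      by case/andP: yi' => _ /le_trans -> //; rewrite ler_nat.
    have lEf : lv e = (lv f).+1.
      apply/eqP; rewrite eqn_leq lfe andbT; case/andP: yi' => _.
      by rewrite yE ler_nat.
    apply: (shared u); rewrite ?inE ?eqxx ?orbT//.
    apply/orP; right; apply/eqP; apply: inj; first by rewrite (edge_proper uw') -/(lv f) -lEf.
    have : line e y = line f y by [].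
    rewrite !lineE yE lEf -natr1 => H; apply/eqP; rewrite -(eqr_int R); apply/eqP.
    by move: H; rewrite /tl /hd /=; lra.
  + have nef : e <> f by move=> ef; apply: ne; case: ef => -> ->.
    have le_ : line e y = line f y by [].
    have fin : (y = (lv e)%:R /\ u = u') \/ (y = (lv e).+1%:R /\ w = w') ->
        exists v, [/\ v \in [:: u; w], v \in [:: u'; w'] & y = height R v].
      case=> -[yE vE]; [apply: (shared u)|apply: (shared w)];
        rewrite ?inE -?vE ?eqxx ?orbT// yE.
      by rewrite (edge_proper uw).
    have [h|h] := orP (edge_lt_total hplanar lef nef); apply: fin.
      exact: (meet e f).
    have := meet f e y h; rewrite -!lef => /(_ yi (esym le_)) [[yE vE]|[yE vE]].
      by left; split=> //; exact: esym vE.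
    by right; split=> //; exact: esym vE.
Qed.

Lemma circulation_flow_of_coord (lambda : nat) phi :
  circulation (F := lambda_network D lambda) phi ->
  phi = flow_of_coord pL pR (coord_of_flow pR phi).
Proof.
move=> [_ _ _ cons].
apply: (conservation_slopes hplanar hembed hL hR hk) cons.
- exact: coord_of_flow_spacing.
- by move=> e; exact: coord_of_flow_slope.
Qed.

Lemma circulation_lambda_drawing (lambda : nat) phi :
  circulation (F := lambda_network D lambda) phi ->
  lambda_drawing R lambda (coord_of_flow pR phi) /\
  forall u v, consecutive u v ->
    coord_of_flow pR phi v - coord_of_flow pR phi u <= space_capacity G lambda.
Proof.
move=> circ; have [ge0 dem cap _] := circ.
set x := coord_of_flow pR phi; have sp : spacing phi x := coord_of_flow_spacing phi.
have mono u v : level u = level v -> X u < X v -> x u < x v.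
  (* Strictness comes from the demand 1 on the last gap before [v]; the flow on the earlier gaps is
     nonnegative. *)
  move=> luv uv; have [g [gv lg ug]] := pred_exists hembed luv uv.
  have : 0 <= x (val g).1 - x u.
    rewrite -(sum_between hplanar hembed)//.
    by apply: sumr_ge0 => g' _; rewrite -sp; exact: ge0.
  by have := dem (space_arc g); rewrite sp gv /=; lia.
split; last first.
  move=> u v uv; pose g : space_pair G := exist _ (u, v) uv.
  by rewrite -(sp g); exact: (cap (space_arc g)).
split.
- exact: level_planar_straight_line.
- move=> u v; rewrite (left_ofE hembed) /= ltr_int.
  have [luv|//] := eqVneq (level u) (level v); rewrite /=.
  apply/idP/idP => [/(mono _ _ luv)//|lt_x]; rewrite ltNge le_eqVlt.
  apply/negP => /orP[/eqP /(xcoord_inj hplanar (esym luv)) vu|/(mono _ _ (esym luv))].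
    by move: lt_x; rewrite vu ltxx.
  by move=> /(lt_trans lt_x); rewrite ltxx.
- move=> u w uw; pose e : edge_pair G := exist _ (u, w) uw.
  (* For edges off [pR] this equality rests on conservation; it turns the bounds on the arc into
     bounds on the slope. *)
  have -> : slope x u w = phi (slope_arc e).
    by rewrite (circulation_flow_of_coord circ) ffunE.
  by rewrite (ge0 (slope_arc e)); exact: (cap (slope_arc e)).
Qed.

End Coordinates.

(** * The two bijections *)

Lemma mutually_inverse_bijections_intro (T U : Type) (A : set T) (B : set U)
    (f : T -> U) (g : U -> T) :
  (forall a, A a -> B (f a) /\ g (f a) = a) ->
  (forall b, B b -> A (g b) /\ f (g b) = b) ->
  mutually_inverse_bijections A B f g.
Proof.
move=> fP gP; split.
- split=> [a /fP[]//|a a' /set_mem/fP[_ {2}<-] /set_mem/fP[_ {2}<-] ->//|b /gP[Ab fb]].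
  by exists (g b).
- split=> [b /gP[]//|b b' /set_mem/gP[_ {2}<-] /set_mem/gP[_ {2}<-] ->//|a /fP[Ba gb]].
  by exists (f a).
- by move=> a /set_mem/fP[].
- by move=> b /set_mem/gP[].
Qed.

Theorem theorem1 (R : realType) (k : nat) (hk : (1 <= k)%N)
    (G : embedded_proper_level_graph k) (pL pR : nat -> G)
    (D : drawing R G) (lambda : nat)
    (hplanar : level_planar D) (hembed : induces_embedding D)
    (hL : left_boundary pL) (hR : right_boundary pR) :
  (* any G: the lambda-drawings whose gaps respect the space-arc capacity *)
  mutually_inverse_bijections
    [set x : {ffun G -> int} |
      [/\ lambda_drawing R lambda x, x (pR 1%N) = 0 &
          forall u v : G, consecutive u v ->
            x v - x u <= space_capacity G lambda]]
    [set phi | circulation (F := lambda_network D lambda) phi]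
    (flow_of_coord pL pR) (coord_of_flow pR) /\
  (* connected G: all lambda-drawings *)
  (graph_connected G ->
   mutually_inverse_bijections
    [set x : {ffun G -> int} | lambda_drawing R lambda x /\ x (pR 1%N) = 0]
    [set phi | circulation (F := lambda_network D lambda) phi]
    (flow_of_coord pL pR) (coord_of_flow pR)).
Proof.
have to_flow x : lambda_drawing R lambda x -> x (pR 1%N) = 0 ->
    (forall u v : G, consecutive u v -> x v - x u <= space_capacity G lambda) ->
    circulation (F := lambda_network D lambda) (flow_of_coord pL pR x) /\
    coord_of_flow pR (flow_of_coord pL pR x) = x.
  move=> dx x0 cap; split; first exact: lambda_drawing_circulation.
  exact: (flow_of_coordK hplanar hembed hL hR).
have to_coord phi : circulation (F := lambda_network D lambda) phi ->
    [/\ lambda_drawing R lambda (coord_of_flow pR phi),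
        coord_of_flow pR phi (pR 1%N) = 0,
        (forall u v : G, consecutive u v ->
          coord_of_flow pR phi v - coord_of_flow pR phi u <= space_capacity G lambda) &
        flow_of_coord pL pR (coord_of_flow pR phi) = phi].
  move=> circ; have [dx cap] := circulation_lambda_drawing hplanar hembed hL hR hk circ.
  split=> //; first exact: coord_of_flow_start.
  by rewrite -(circulation_flow_of_coord hplanar hembed hL hR hk circ).
split=> [|conn]; apply: mutually_inverse_bijections_intro.
- by move=> x [dx x0 cap]; exact: to_flow.
- by move=> phi /to_coord[].
- move=> x [dx x0]; apply: to_flow => //.
  (* Connectedness supplies the bound on the gaps. *)
  by have [_ _ sl] := dx; move=> u v; exact: (connected_gap hembed conn sl).
- by move=> phi /to_coord[].
Qed.
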